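(* Let $(\Omega,\mathcal A)$ be a measurable space, let $U\subset\mathbb C^n$ be a connected Reinhardt domain, and let $f(\omega,z)$ be a random holomorphic function in $U$. Then $f$ has a unique expansion as a random Laurent series $\sum_{\nu\in\mathbb Z^n}c_\nu(\omega)z^\nu$ (with each $c_\nu:\Omega\to\mathbb C$ measurable), and for every $\omega\in\Omega$ the series converges normally on $U$ to $f(\omega,\cdot)$.
   Context: A connected Reinhardt domain is a connected open set $U\subset\mathbb C^n$ such that for every $z\in U$ and all $\theta_1,\ldots,\theta_n\in\mathbb R$, $(e^{i\theta_1}z_1,\ldots,e^{i\theta_n}z_n)\in U$. A random holomorphic function on $U$ is $f:\Omega\times U\to\mathbb C$ with $f(\omega,\cdot)$ holomorphic for each $\omega$ and $f(\cdot,z)$ measurable for each $z$. A formal Laurent series $\sum_{\nu\in\mathbb Z^n}a_\nu z^\nu$ converges normally in $U$ if for every compact $K\subset U$ and every $\varepsilon>0$ there is a finite set $\Lambda\subset\mathbb Z^n$ with $\sum_{\nu\notin\Lambda}|a_\nu z^\nu|<\varepsilon$ for all $z\in K$. *)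

(* Defs.v *)
From HB Require Import structures.
From mathcomp Require Import all_boot all_order all_algebra.
From mathcomp Require Import all_classical all_reals all_analysis.
From mathcomp Require Import complex.
Set Implicit Arguments. Unset Strict Implicit. Unset Printing Implicit Defensive.
Import Order.TTheory GRing.Theory Num.Theory.
Import numFieldNormedType.Exports.
Local Open Scope classical_set_scope.
Local Open Scope ring_scope.

(* Points of C^n are row vectors 'rV[R[i]^o]_n; R[i] is a numFieldType, so
   'rV[R[i]^o]_n carries MathComp-Analysis' normed-module (and topological)
   structure over the scalar field R[i]. *)

Definition reinhardt_domain (R : realType) (n : nat) (U : set 'rV[R[i]^o]_n) :=
  [/\ open U, connected U, U !=set0 &
      forall z, U z -> forall theta : 'I_n -> R,
        U (\row_j ((cos (theta j) +i* sin (theta j))%C * z ord0 j))].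

(* Holomorphic on an open set: complex (Frechet, R[i]-linear) differentiable
   at every point. *)
Definition holomorphic_on (R : realType) (n : nat) (U : set 'rV[R[i]^o]_n)
  (g : 'rV[R[i]^o]_n -> R[i]^o) := forall z, U z -> differentiable g z.

(* Measurability of a C-valued map for the Borel sigma-algebra of C = R^2:
   real and imaginary parts are measurable. *)
Definition measurable_cplx (d : measure_display) (T : measurableType d)
  (R : realType) (h : T -> R[i]^o) :=
  measurable_fun setT (fun w => complex.Re (h w)) /\
  measurable_fun setT (fun w => complex.Im (h w)).

Definition random_holomorphic (d : measure_display) (T : measurableType d)
  (R : realType) (n : nat) (U : set 'rV[R[i]^o]_n)
  (f : T -> 'rV[R[i]^o]_n -> R[i]^o) :=
  (forall w, holomorphic_on U (f w)) /\ (forall z, measurable_cplx (fun w => f w z)).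

(* Multi-index monomial z^nu = prod_j z_j^{nu_j}, nu in Z^n (integer powers;
   x ^ (-k) = (x ^+ k)^-1, with the MathComp convention 0^-1 = 0). *)
Definition monom (R : realType) (n : nat) (z : 'rV[R[i]^o]_n) (nu : 'rV[int]_n)
  : R[i]^o := \prod_(j < n) (z ord0 j) ^ (nu ord0 j).

Definition normally_convergent (R : realType) (n : nat) (U : set 'rV[R[i]^o]_n)
  (a : 'rV[int]_n -> R[i]^o) :=
  forall K : set 'rV[R[i]^o]_n, compact K -> K `<=` U ->
  forall eps : R, 0 < eps ->
  exists Lam : set 'rV[int]_n, finite_set Lam /\
    forall z, K z ->
      (\esum_(nu in ~` Lam) (Normc.normc (a nu * monom z nu))%:E < eps%:E)%E.

Definition laurent_sum_at (R : realType) (n : nat) (a : 'rV[int]_n -> R[i]^o)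
  (z : 'rV[R[i]^o]_n) (v : R[i]^o) :=
  forall eps : R, 0 < eps ->
  exists Lam0 : set 'rV[int]_n, finite_set Lam0 /\
    forall Lam : set 'rV[int]_n, finite_set Lam -> Lam0 `<=` Lam ->
      Normc.normc (v - \sum_(nu \in Lam) a nu * monom z nu) < eps.

Definition converges_normally_to (R : realType) (n : nat)
  (U : set 'rV[R[i]^o]_n) (a : 'rV[int]_n -> R[i]^o) (g : 'rV[R[i]^o]_n -> R[i]^o) :=
  normally_convergent U a /\ forall z, U z -> laurent_sum_at a z (g z).

(* Main.v *)
Require Import Defs.
From HB Require Import structures.
From mathcomp Require Import all_boot all_order all_algebra.
From mathcomp Require Import all_classical all_reals all_analysis.
From mathcomp Require Import complex.
From mathcomp Require Import measurable_realfun ring lra zify.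
Import Order.TTheory GRing.Theory Num.Theory.
Import numFieldNormedType.Exports.
Local Open Scope classical_set_scope.
Local Open Scope ring_scope.

(** The coefficient of [z^nu] in [g] is [c nu = F(z0) / z0^nu], where [F(z)] is the mean
    of [th |-> g (e^(i th) z) e^(-i nu.th)] over the torus and [z0] is a point of [U]
    without zero coordinates. Means over the torus are limits of averages over the grids
    of [N]-th roots of unity; so they are measurable in the random parameter, and an
    estimate in one variable transfers to [n] variables by averaging over the others.

    Complex differentiability alone gives Goursat's lemma on rectangles, by bisection. In
    logarithmic coordinates of one variable it shows that [F(z) / z^nu] does not change
    when a single coordinate moves inside a polyannulus, hence is locally constant, hence
    constant because [U] is connected: [F(z) = c nu * z^nu] on [U], also at points with
    zero coordinates. Evaluating this identity at [y] with [|y_j|] slightly larger or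
    smaller than [|z_j|], according to the sign of [nu_j], bounds [|c nu * z^nu|] by
    [M * q^|nu|] with [q < 1], locally uniformly; this is normal convergence.

    The sum is [g]: if all but a tail of the Fourier coefficients are removed from [g],
    the Fejer means of the remainder are bounded by the tail and converge to the remainder.
    Uniqueness: a normally convergent series can be averaged term by term on the torus
    of [z0]. *)

Set Implicit Arguments. Unset Strict Implicit. Unset Printing Implicit Defensive.

(** * Complex modulus and the unit circle *)

(** Goursat's bisection needs just a first-order expansion at each point. Its outcome is stated for
    finite grid averages, with an error controlled by a modulus of continuity; such a bound can be
    averaged over the remaining angles by rearranging finite sums, and a limit is taken only
    afterwards. Thus integrals occur only along the sides of rectangles, and no theorem on iterated
    integrals enters.

    Identities between coefficients at two points are cross-multiplied. The convention 0^-1 = 0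
    makes a monomial vanish wherever z_j = 0 and nu_j != 0, and the coefficient mean vanishes there
    too, so one identity covers all of [U].

    Fejer means suit the last step because they use only the continuity of g, and because their
    kernel is nonnegative with mean exactly 1 on every sufficiently fine grid. *)

Notation nm := Normc.normc.

Section ComplexModulus.
Variable R : realType.
Implicit Types (x y z : R[i]) (t : R).

Lemma nm0 : nm (0 : R[i]) = 0.
Proof. by rewrite /= expr0n /= addr0 sqrtr0. Qed.

Lemma nm_real t : nm (t%:C)%C = `|t|.
Proof. by rewrite /= expr0n /= addr0 sqrtr_sqr. Qed.

Lemma nm1 : nm (1 : R[i]) = 1.
Proof. by rewrite (nm_real 1) normr1. Qed.

Lemma nm_ge0 z : 0 <= nm z.
Proof. by case: z => a b /=; exact: sqrtr_ge0. Qed.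

Lemma nm_eq0 z : (nm z == 0) = (z == 0).
Proof. by apply/eqP/eqP => [/Normc.eq0_normc //|->]; exact: nm0. Qed.

Lemma nm_gt0 z : (0 < nm z) = (z != 0).
Proof. by rewrite lt_def nm_ge0 nm_eq0 andbT. Qed.

Lemma nmM x y : nm (x * y) = nm x * nm y.
Proof. exact: Normc.normcM. Qed.

Lemma nmV x : nm x^-1 = (nm x)^-1.
Proof. exact: Normc.normcV. Qed.

Lemma nmN x : nm (- x) = nm x.
Proof. exact: normcN. Qed.

Lemma nmD x y : nm (x + y) <= nm x + nm y.
Proof. exact: le_normcD. Qed.

Lemma nmB x y : nm (x - y) = nm (y - x).
Proof. by rewrite -nmN opprB. Qed.

Lemma nm_dist y x z : nm (x - z) <= nm (x - y) + nm (y - z).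
Proof. by rewrite (le_trans _ (nmD _ _)) // addrA subrK. Qed.

Lemma nm_sum (I : Type) (r : seq I) (P : pred I) (F : I -> R[i]) :
  nm (\sum_(i <- r | P i) F i) <= \sum_(i <- r | P i) nm (F i).
Proof.
elim/big_ind2 : _ => [|x1 x2 y1 y2 h1 h2|//]; first by rewrite nm0.
exact: le_trans (nmD _ _) (lerD h1 h2).
Qed.

Lemma nm_prod (I : Type) (r : seq I) (P : pred I) (F : I -> R[i]) :
  nm (\prod_(i <- r | P i) F i) = \prod_(i <- r | P i) nm (F i).
Proof. by apply: (big_morph _ nmM nm1). Qed.

Lemma nm_exprn z (k : nat) : nm (z ^+ k) = nm z ^+ k.
Proof. by elim: k => [|k ih]; rewrite ?expr0 ?nm1 // !exprS nmM ih. Qed.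

Lemma nm_exprz z (k : int) : nm (z ^ k) = nm z ^ k.
Proof.
case: k => k; first exact: nm_exprn.
by rewrite -[z ^ _]/((z ^+ k.+1)^-1) nmV nm_exprn.
Qed.

Lemma Re_le_nm z : `|complex.Re z| <= nm z.
Proof.
by case: z => a b /=; rewrite -(sqrtr_sqr a) ler_wsqrtr // lerDl sqr_ge0.
Qed.

Lemma Im_le_nm z : `|complex.Im z| <= nm z.
Proof.
by case: z => a b /=; rewrite -(sqrtr_sqr b) ler_wsqrtr // lerDr sqr_ge0.
Qed.

Lemma nm_le_ReIm z : nm z <= `|complex.Re z| + `|complex.Im z|.
Proof.
rewrite {1}[z]complexE (le_trans (nmD _ _)) // nmM !nm_real.
have -> : nm ('i%C : R[i]) = 1 by rewrite /= expr0n expr1n add0r sqrtr1.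
by rewrite mul1r.
Qed.

Lemma normrE_nm z : `|z| = ((nm z)%:C)%C.
Proof. by rewrite normc_def; case: z. Qed.

Lemma Re_D x y : complex.Re (x + y) = complex.Re x + complex.Re y.
Proof. by case: x; case: y. Qed.
Lemma Im_D x y : complex.Im (x + y) = complex.Im x + complex.Im y.
Proof. by case: x; case: y. Qed.
Lemma Re_N x : complex.Re (- x) = - complex.Re x.
Proof. by case: x. Qed.
Lemma Im_N x : complex.Im (- x) = - complex.Im x.
Proof. by case: x. Qed.
Lemma Re_M x y :
  complex.Re (x * y) = complex.Re x * complex.Re y - complex.Im x * complex.Im y.
Proof. by case: x; case: y. Qed.
Lemma Im_M x y :
  complex.Im (x * y) = complex.Re x * complex.Im y + complex.Im x * complex.Re y.
Proof. by case: x => a b; case: y => c e /=; rewrite [b * _]mulrC. Qed.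

Definition expi t : R[i] := (cos t +i* sin t)%C.

Lemma expi0 : expi 0 = 1.
Proof. by rewrite /expi cos0 sin0. Qed.

Lemma expiD s t : expi (s + t) = expi s * expi t.
Proof.
rewrite /expi cosD sinD; apply/eqP; rewrite eq_complex /=.
by apply/andP; split; apply/eqP; ring.
Qed.

Lemma nm_expi t : nm (expi t) = 1.
Proof. by rewrite /= cos2Dsin2 sqrtr1. Qed.

Lemma expi_neq0 t : expi t != 0.
Proof. by rewrite -nm_eq0 nm_expi oner_eq0. Qed.

Lemma expiN t : expi (- t) = (expi t)^-1.
Proof. by apply: (mulfI (expi_neq0 t)); rewrite mulfV ?expi_neq0// -expiD subrr expi0. Qed.

Lemma expi_nat t (k : nat) : expi (t * k%:R) = expi t ^+ k.
Proof.
elim: k => [|k ih]; first by rewrite mulr0 expi0 expr0.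
by rewrite -natr1 mulrDr mulr1 expiD ih exprSr.
Qed.

Lemma expi_int t (k : int) : expi (t * k%:~R) = expi t ^ k.
Proof.
case: k => k; first exact: expi_nat.
by rewrite -[RHS]/((expi t ^+ k.+1)^-1) -expi_nat NegzE mulrNz mulrN expiN.
Qed.

Lemma expi_2pi (k : int) : expi (2 * pi * k%:~R) = 1.
Proof.
rewrite expi_int.
have -> : expi (2 * pi) = 1 by rewrite mulr_natl /expi cos2pi sin2pi.
by rewrite exp1rz.
Qed.

Lemma expi_2pin (k : nat) : expi (2 * pi * k%:R) = 1.
Proof. exact: (expi_2pi k%:Z). Qed.

Lemma polar z : exists t, z = ((nm z)%:C)%C * expi t.
Proof.
have [->|z0] := eqVneq z 0.
  by exists 0; rewrite nm0 (_ : (0%:C)%C = 0 :> R[i]) // mul0r.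
have m0 : 0 < nm z by rewrite nm_gt0.
have [u zE] : exists u, z = ((nm z)%:C)%C * u.
  exists (((nm z)%:C)%C^-1 * z); rewrite mulrA mulfV ?mul1r//.
  by rewrite -nm_eq0 nm_real normr_eq0 gt_eqF.
have nu : nm u = 1.
  move/(congr1 (fun z => nm z)) : zE; rewrite nmM nm_real ger0_norm ?nm_ge0//.
  by move=> h; apply: (mulfI (lt0r_neq0 m0)); rewrite -h mulr1.
suff [t uE] : exists t, u = expi t by exists t; rewrite -uE.
case: u nu {zE} => a b /= nu.
have ab : a ^+ 2 + b ^+ 2 = 1.
  by rewrite -(sqr_sqrtr (_ : 0 <= a ^+ 2 + b ^+ 2)) ?addr_ge0 ?sqr_ge0// nu expr1n.
have a1 : -1 <= a <= 1.
  by apply/andP; split; nra.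
have ca : cos (acos a) = a by rewrite acosK // in_itv.
have [b0|b0] := leP 0 b.
  exists (acos a); rewrite /expi ca sin_acos //; congr (_ +i* _)%C.
  by rewrite -ab addrAC subrr add0r sqrtr_sqr ger0_norm.
exists (- acos a); rewrite /expi cosN sinN ca sin_acos //; congr (_ +i* _)%C.
by rewrite -ab addrAC subrr add0r sqrtr_sqr ltr0_norm // opprK.
Qed.

End ComplexModulus.

(** * Goursat's lemma on rectangles *)

Section SegmentIntegral.
Variable R : realType.
Implicit Types (a b c m x : R) (f g : R -> R).

Definition continuous_on_segment a b f := forall x, a <= x <= b ->
  forall e, 0 < e -> exists2 d, 0 < d &
  forall y, a <= y <= b -> `|y - x| < d -> `|f y - f x| < e.

Definition segment_integral a b f :=
  \int[@lebesgue_measure R]_(x in `[a, b]) f x.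

Lemma continuous_on_segmentS a b c d f : a <= c -> d <= b ->
  continuous_on_segment a b f -> continuous_on_segment c d f.
Proof.
move=> ac db cf x /andP[cx xd] e e0.
have [|r r0 h] := cf x _ e e0.
  by rewrite (le_trans ac) // (le_trans xd).
by exists r => // y /andP[cy yd]; apply: h; rewrite (le_trans ac) // (le_trans yd).
Qed.

Lemma continuous_on_segment_integrable a b f : continuous_on_segment a b f ->
  (@lebesgue_measure R).-integrable `[a, b] (EFin \o f).
Proof.
move=> cf; apply: continuous_compact_integrable; first exact: segment_compact.
apply/subspace_continuousP => x /=; rewrite in_itv /= => xab.
apply/cvgrPdist_lt => e e0; have [d d0 h] := cf x xab e e0.
rewrite near_withinE; apply/nbhs_ballP; exists d => //= y.
rewrite /ball /= distrC => xy; rewrite in_itv /= => yab.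
by rewrite distrC; exact: h.
Qed.

Lemma segment_integral_split a m b f : a <= m -> m <= b ->
  continuous_on_segment a b f ->
  segment_integral a b f = segment_integral a m f + segment_integral m b f.
Proof.
move=> am mb /continuous_on_segment_integrable fi.
have mbi : (@lebesgue_measure R).-integrable `]m, b] (EFin \o f).
  apply: integrableS fi => //; apply: subset_itv; rewrite bnd_simp //.
rewrite -[X in _ + X]Rintegral_itv_obnd_cbnd // -(@Rintegral_itvB _ f (BLeft a) _ m) //.
by rewrite addrC subrK.
Qed.

(** Serves twice: for opposite sides of a small rectangle, with [k] the first-order difference of
    the integrands, and for one cell of a Riemann sum, with [g = 0] and [k] the sampled value. *)
Lemma segment_integral_close a b f g k M : a <= b ->
  continuous_on_segment a b f -> continuous_on_segment a b g ->
  (forall x, a <= x <= b -> `|f x - g x - k| <= M) ->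
  `|segment_integral a b f - segment_integral a b g - k * (b - a)|
    <= M * (b - a).
Proof.
move=> ab /continuous_on_segment_integrable fi /continuous_on_segment_integrable gi h.
have mu_ab : fine ((@lebesgue_measure R) `[a, b]%classic) = b - a.
  by rewrite lebesgue_measure_itv /= lte_fin; case: ltgtP ab => // ->; rewrite subrr.
have cst_i r : (@lebesgue_measure R).-integrable `[a, b] (EFin \o cst r).
  apply: continuous_compact_integrable; first exact: segment_compact.
  by move=> ?; exact: cvg_cst.
have fgi : (@lebesgue_measure R).-integrable `[a, b] (EFin \o (fun x => f x - g x)).
  by apply: (integrableB _ fi gi).
have fgki : (@lebesgue_measure R).-integrable `[a, b] (EFin \o (fun x => f x - g x - k)).
  by apply: (integrableB _ fgi (cst_i k)).
have E : segment_integral a b f - segment_integral a b g - k * (b - a) =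
         \int[@lebesgue_measure R]_(x in `[a, b]) (f x - g x - k).
  have -> := RintegralB _ fgi (cst_i k) => //.
  have -> := RintegralB _ fi gi => //.
  by rewrite Rintegral_cst // mu_ab.
rewrite E -mu_ab -Rintegral_cst // (le_trans (le_normr_Rintegral _ _)) //.
by apply: le_Rintegral => //; [exact: integrable_norm|exact: cst_i].
Qed.

End SegmentIntegral.

Section Goursat.
Variables (R : realType) (P Q : R -> R -> R) (a b c d : R).
Hypotheses (ab : a <= b) (cd : c <= d).

(* The 1-form P ds + Q dt is differentiable at every point of the rectangle and
   closed there: the two cross derivatives are the same number p2. *)
Hypothesis closed_form : forall s0 t0, a <= s0 <= b -> c <= t0 <= d ->
  exists p1 p2 q2, forall e, 0 < e -> exists2 r, 0 < r &
    forall s t, a <= s <= b -> c <= t <= d -> `|s - s0| < r -> `|t - t0| < r ->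
    `|P s t - P s0 t0 - p1 * (s - s0) - p2 * (t - t0)|
       <= e * (`|s - s0| + `|t - t0|) /\
    `|Q s t - Q s0 t0 - p2 * (s - s0) - q2 * (t - t0)|
       <= e * (`|s - s0| + `|t - t0|).

Let contP t : c <= t <= d -> continuous_on_segment a b (P ^~ t).
Proof.
move=> tcd x xab e e0.
have [p1 [p2 [q2 /(_ _ ltr01) [r r0 h]]]] := closed_form xab tcd.
have p0 : 0 < `|p1| + 1 by rewrite ltr_wpDl.
exists (Num.min r (e / (`|p1| + 1))); first by rewrite lt_min r0 divr_gt0.
move=> y yab; rewrite lt_min => /andP[yr ye].
have [|+ _] := h y t yab tcd yr; first by rewrite subrr normr0.
rewrite subrr mulr0 subr0 normr0 addr0 mul1r => h1.
rewrite -(subrK (p1 * (y - x)) (P y t - P x t)) (le_lt_trans (ler_normD _ _)) //.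
rewrite (le_lt_trans (lerD h1 (lexx _))) // normrM -{1}(mul1r `|y - x|) -mulrDl.
by rewrite addrC mulrC -ltr_pdivlMr.
Qed.

Lemma closed_form_continuous s : a <= s <= b -> continuous_on_segment c d (Q s).
Proof.
move=> sab x xcd e e0.
have [p1 [p2 [q2 /(_ _ ltr01) [r r0 h]]]] := closed_form sab xcd.
have p0 : 0 < `|q2| + 1 by rewrite ltr_wpDl.
exists (Num.min r (e / (`|q2| + 1))); first by rewrite lt_min r0 divr_gt0.
move=> y ycd; rewrite lt_min => /andP[yr ye].
have [|_] := h s y sab ycd _ yr; first by rewrite subrr normr0.
rewrite subrr mulr0 subr0 normr0 add0r mul1r => h1.
rewrite -(subrK (q2 * (y - x)) (Q s y - Q s x)) (le_lt_trans (ler_normD _ _)) //.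
rewrite (le_lt_trans (lerD h1 (lexx _))) // normrM -{1}(mul1r `|y - x|) -mulrDl.
by rewrite addrC mulrC -ltr_pdivlMr.
Qed.

(** The integral of P ds + Q dt along the boundary of [x, x'] x [y, y'], counterclockwise. *)
Let E x x' y y' := segment_integral x x' (P ^~ y) + segment_integral y y' (Q x')
  - segment_integral x x' (P ^~ y') - segment_integral y y' (Q x).

(** Each inner side is traversed twice, in opposite directions. *)
Let E_split x m x' y k y' : a <= x -> x <= m -> m <= x' -> x' <= b ->
  c <= y -> y <= k -> k <= y' -> y' <= d ->
  E x x' y y' = E x m y k + E m x' y k + E x m k y' + E m x' k y'.
Proof.
move=> ax xm mx' x'b cy yk ky' y'd; rewrite /E.
have sP t : c <= t <= d -> segment_integral x x' (P ^~ t) =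
    segment_integral x m (P ^~ t) + segment_integral m x' (P ^~ t).
  move=> /contP ct; apply: segment_integral_split => //.
  exact: continuous_on_segmentS ct.
have sQ s : a <= s <= b -> segment_integral y y' (Q s) =
    segment_integral y k (Q s) + segment_integral k y' (Q s).
  move=> /closed_form_continuous ct; apply: segment_integral_split => //.
  exact: continuous_on_segmentS ct.
rewrite !sP ?sQ; try lra.
all: by apply/andP; split; lra.
Qed.

(** In the difference over two opposite sides the [p1] (or [q2]) terms cancel at equal parameters.
    What remains of first order is [p2] times the area, once with each sign, because both cross
    derivatives are [p2]; only the error terms survive. *)
Let E_local s0 t0 e : a <= s0 <= b -> c <= t0 <= d -> 0 < e ->
  exists2 r, 0 < r & forall x x' y y', a <= x -> x' <= b -> c <= y -> y' <= d ->
    x <= s0 <= x' -> y <= t0 <= y' -> x' - x < r -> y' - y < r ->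
    `|E x x' y y'| <= 2 * e * (x' - x + (y' - y)) ^+ 2.
Proof.
move=> sab tcd e0; have [p1 [p2 [q2 /(_ _ e0) [r r0 h]]]] := closed_form sab tcd.
exists r => // x x' y y' ax x'b cy y'd /andP[xs sx'] /andP[yt ty'] xr yr.
have hP : `|segment_integral x x' (P ^~ y) - segment_integral x x' (P ^~ y') -
    p2 * (y - y') * (x' - x)| <= 2 * e * (x' - x + (y' - y)) * (x' - x).
  apply: segment_integral_close; first lra.
  - apply: (@continuous_on_segmentS _ a b) => //; apply: contP; lra.
  - apply: (@continuous_on_segmentS _ a b) => //; apply: contP; lra.
  move=> s /andP[xs' sx].
  have s0le : `|s - s0| <= x' - x by rewrite ler_norml; lra.
  have [||||h1 _] := h s y; [lra|lra|lra|by rewrite ltr_norml; lra|].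
  have [||||h2 _] := h s y'; [lra|lra|lra|by rewrite ltr_norml; lra|].
  have -> : P s y - P s y' - p2 * (y - y') =
    (P s y - P s0 t0 - p1 * (s - s0) - p2 * (y - t0)) -
    (P s y' - P s0 t0 - p1 * (s - s0) - p2 * (y' - t0)) by ring.
  rewrite (le_trans (ler_normB _ _)) // (le_trans (lerD h1 h2)) // -mulrDr.
  rewrite [2 * e]mulrC -mulrA ler_wpM2l ?(ltW e0) //.
  have -> : `|y - t0| = t0 - y by rewrite ler0_norm; lra.
  have -> : `|y' - t0| = y' - t0 by rewrite ger0_norm; lra.
  lra.
have hQ : `|segment_integral y y' (Q x') - segment_integral y y' (Q x) -
    p2 * (x' - x) * (y' - y)| <= 2 * e * (x' - x + (y' - y)) * (y' - y).
  apply: segment_integral_close; first lra.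
  - apply: (@continuous_on_segmentS _ c d) => //; apply: closed_form_continuous; lra.
  - apply: (@continuous_on_segmentS _ c d) => //; apply: closed_form_continuous; lra.
  move=> t /andP[yt' ty].
  have t0le : `|t - t0| <= y' - y by rewrite ler_norml; lra.
  have [||||_ h1] := h x' t; [lra|lra|by rewrite ltr_norml; lra|lra|].
  have [||||_ h2] := h x t; [lra|lra|by rewrite ltr_norml; lra|lra|].
  have -> : Q x' t - Q x t - p2 * (x' - x) =
    (Q x' t - Q s0 t0 - p2 * (x' - s0) - q2 * (t - t0)) -
    (Q x t - Q s0 t0 - p2 * (x - s0) - q2 * (t - t0)) by ring.
  rewrite (le_trans (ler_normB _ _)) // (le_trans (lerD h1 h2)) // -mulrDr.
  rewrite [2 * e]mulrC -mulrA ler_wpM2l ?(ltW e0) //.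
  have -> : `|x' - s0| = x' - s0 by rewrite ger0_norm; lra.
  have -> : `|x - s0| = s0 - x by rewrite ler0_norm; lra.
  lra.
have -> : E x x' y y' =
  (segment_integral x x' (P ^~ y) - segment_integral x x' (P ^~ y') -
    p2 * (y - y') * (x' - x)) +
  (segment_integral y y' (Q x') - segment_integral y y' (Q x) -
    p2 * (x' - x) * (y' - y)) by rewrite /E; ring.
rewrite (le_trans (ler_normD _ _)) // (le_trans (lerD hP hQ)) // -mulrDr.
by rewrite expr2 mulrA.
Qed.

Let side (w : R) k := w / 2 ^+ k.

Let side_split w k : side w k = side w k.+1 + side w k.+1.
Proof. by rewrite /side exprSr invfM; field; rewrite expf_neq0 // pnatr_eq0. Qed.

Let side_ge0 w k : 0 <= w -> 0 <= side w k.
Proof. by move=> w0; rewrite divr_ge0 // exprn_ge0. Qed.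

Let W := b - a.
Let H := d - c.
Let cell k (p : R * R) := E p.1 (p.1 + side W k) p.2 (p.2 + side H k).
Let inside k (p : R * R) := (a <= p.1 /\ p.1 + side W k <= b) /\
                            (c <= p.2 /\ p.2 + side H k <= d).
Let next k (p p' : R * R) := inside k.+1 p' /\
  (p.1 <= p'.1 /\ p'.1 + side W k.+1 <= p.1 + side W k) /\
  (p.2 <= p'.2 /\ p'.2 + side H k.+1 <= p.2 + side H k) /\
  `|cell k p| <= 4 * `|cell k.+1 p'|.

(** The boundary integral is the sum over the four quarters, so some quarter carries at least a
    fourth of its absolute value. *)
Let next_exists k p : inside k p -> exists p', next k p p'.
Proof.
case: p => x y [/= [ax xb] [cy yd]].
have sW : 0 <= side W k.+1 by rewrite side_ge0 // subr_ge0.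
have sH : 0 <= side H k.+1 by rewrite side_ge0 // subr_ge0.
have EW := side_split W k; have EH := side_split H k.
apply: contrapT => nex.
have small i j : (i <= 1)%N -> (j <= 1)%N ->
    4 * `|cell k.+1 (x + i%:R * side W k.+1, y + j%:R * side H k.+1)| <
    `|cell k (x, y)|.
  move=> i1 j1; rewrite ltNge; apply/negP => le4; apply: nex.
  have i01 : 0 <= i%:R * side W k.+1 <= side W k.+1.
    by case: i i1 {le4} => [|[|//]] _; rewrite ?mul0r ?mul1r ?lexx ?sW.
  have j01 : 0 <= j%:R * side H k.+1 <= side H k.+1.
    by case: j j1 {le4} => [|[|//]] _; rewrite ?mul0r ?mul1r ?lexx ?sH.
  exists (x + i%:R * side W k.+1, y + j%:R * side H k.+1).
  move: (i%:R * side W k.+1) (j%:R * side H k.+1) i01 j01 le4 => u v.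
  move=> /andP[u0 u1] /andP[v0 v1] le4; split; last split; last split=> //=.
  - by split => /=; split; lra.
  - by split => /=; lra.
  - by split => /=; lra.
have h00 := small 0%N 0%N isT isT; have h10 := small 1%N 0%N isT isT.
have h01 := small 0%N 1%N isT isT; have h11 := small 1%N 1%N isT isT.
rewrite !mul0r !addr0 !mul1r in h00 h10 h01 h11.
have eqE : cell k (x, y) = cell k.+1 (x, y) + cell k.+1 (x + side W k.+1, y)
   + cell k.+1 (x, y + side H k.+1)
   + cell k.+1 (x + side W k.+1, y + side H k.+1).
  have cE k' u v : cell k' (u, v) = E u (u + side W k') v (v + side H k') by [].
  rewrite !cE EW EH !(addrA x) !(addrA y).
  by apply: E_split; rewrite ?lerDl // -addrA -?EW -?EH.
have : `|cell k (x, y)| <= `|cell k.+1 (x, y)| + `|cell k.+1 (x + side W k.+1, y)|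
   + `|cell k.+1 (x, y + side H k.+1)|
   + `|cell k.+1 (x + side W k.+1, y + side H k.+1)|.
  rewrite eqE; do 2![rewrite (le_trans (ler_normD _ _)) // lerD2r].
  exact: ler_normD.
lra.
Qed.

(** The fallback [p] only makes the choice total; [corner] never meets it, since all its cells lie
    inside the rectangle. *)
Let pick_next k p := if pselect (exists p', next k p p') is left h
  then projT1 (cid h) else p.
Let corner := fix corner k := if k is k'.+1 then pick_next k' (corner k') else (a, c).

Let corner_inside k : inside k (corner k).
Proof.
elim: k => [|k ih] /=.
  by rewrite /inside /= /side !divr1 /W /H; split; split; lra.
rewrite /pick_next; case: pselect => [h|/(_ (next_exists ih))//].
by case: (cid h) => p' [].
Qed.

Let corner_next k : next k (corner k) (corner k.+1).
Proof.
rewrite /= /pick_next; case: pselect => [h|/(_ (next_exists (corner_inside k)))//].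
by case: (cid h).
Qed.

Let cell_corner k : `|E a b c d| <= 4 ^+ k * `|cell k (corner k)|.
Proof.
elim: k => [|k ih].
  have aW : a + side W 0 = b by rewrite /side divr1 /W addrC subrK.
  have cH : c + side H 0 = d by rewrite /side divr1 /H addrC subrK.
  by rewrite -[cell 0 _]/(E a (a + side W 0) c (c + side H 0)) aW cH expr0 mul1r.
rewrite (le_trans ih) // exprSr -mulrA ler_wpM2l ?exprn_ge0 //.
by have [_ [_ [_]]] := corner_next k.
Qed.

(** The common point is the supremum of the left ends; the lengths need not tend to 0. *)
Let nested (x l : nat -> R) : (forall k, x k <= x k.+1) ->
  (forall k, x k.+1 + l k.+1 <= x k + l k) -> (forall k, 0 <= l k) ->
  exists p, forall k, x k <= p <= x k + l k.
Proof.
move=> xS lS l0.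
have xn j k : (j <= k)%N -> x j <= x k.
  by move=> /subnK <-; elim: (k - j)%N => [|n ih]; rewrite ?add0n // addSn (le_trans ih).
have ln j k : (j <= k)%N -> x k + l k <= x j + l j.
  by move=> /subnK <-; elim: (k - j)%N => [|n ih]; rewrite ?add0n // addSn (le_trans _ ih).
have xl j k : x j <= x k + l k.
  have [jk|/ltnW kj] := leqP j k; first by rewrite (le_trans (xn _ _ jk)) // lerDl.
  by rewrite (le_trans _ (ln _ _ kj)) // lerDl.
exists (sup (range x)) => k; apply/andP; split.
  by apply: ub_le_sup; [exists (x k + l k) => _ [j _ <-]|exists k].
by apply: ge_sup; [exists (x 0%N), 0%N|move=> _ [j _ <-]].
Qed.

Lemma goursat_rectangle :
  segment_integral a b (P ^~ c) + segment_integral c d (Q b)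
  - segment_integral a b (P ^~ d) - segment_integral c d (Q a) = 0.
Proof.
rewrite -/(E a b c d); apply/eqP; rewrite -normr_le0 leNgt; apply/negP => E0.
have [s0 hs] : exists p, forall k, (corner k).1 <= p <= (corner k).1 + side W k.
  apply: nested => [k|k|k]; last by rewrite side_ge0 // subr_ge0.
    by have [_ [[]]] := corner_next k.
  by have [_ [[]]] := corner_next k.
have [t0 ht] : exists p, forall k, (corner k).2 <= p <= (corner k).2 + side H k.
  apply: nested => [k|k|k]; last by rewrite side_ge0 // subr_ge0.
    by have [_ [_ [[]]]] := corner_next k.
  by have [_ [_ [[]]]] := corner_next k.
have W0 : 0 <= W by rewrite subr_ge0.
have H0 : 0 <= H by rewrite subr_ge0.
have sab : a <= s0 <= b by have := hs 0%N; rewrite /= /side divr1 /W; lra.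
have tcd : c <= t0 <= d by have := ht 0%N; rewrite /= /side divr1 /H; lra.
pose D := (W + H) ^+ 2; have D0 : 0 <= D by rewrite sqr_ge0.
(* With this value the final bound 2 e D is less than half of [|E a b c d|]; [D + 1] avoids dividing
   by 0 for a degenerate rectangle. *)
have e0 : 0 < `|E a b c d| / (4 * (D + 1)) by rewrite divr_gt0 // mulr_gt0 //; lra.
have [r r0 hr] := E_local sab tcd e0.
have [k hk] : exists k : nat, (W + H) / r < 2 ^+ k.
  have [m hm] : exists m : nat, (W + H) / r < m%:R.
    exists (Num.bound ((W + H) / r)).
    exact: archi_boundP (divr_ge0 (addr_ge0 W0 H0) (ltW r0)).
  exists m; rewrite (lt_trans hm) //.
  have -> : 2 ^+ m = (2 ^ m)%:R :> R by rewrite natrX.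
  by rewrite ltr_nat ltn_expl.
have k0 : 0 < 2 ^+ k :> R by rewrite exprn_gt0.
have [[xa xb] [yc yd]] := corner_inside k.
have sWr : side W k < r.
  rewrite /side ltr_pdivrMr // mulrC -ltr_pdivrMr // (le_lt_trans _ hk) //.
  by rewrite ler_wpM2r ?invr_ge0 ?(ltW r0) // lerDl.
have sHr : side H k < r.
  rewrite /side ltr_pdivrMr // mulrC -ltr_pdivrMr // (le_lt_trans _ hk) //.
  by rewrite ler_wpM2r ?invr_ge0 ?(ltW r0) // lerDr.
have := hr _ _ _ _ xa xb yc yd (hs k) (ht k).
rewrite ![_ + side _ _ - _]addrAC !subrr !add0r => /(_ sWr sHr).
rewrite -/(cell k (corner k)) => le1.
have le2 := cell_corner k.
(* Each bisection may lose a factor 4 in the integral, and it divides the squared sum of the sides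
   by 4, so the bound does not depend on [k]. *)
have E4 : 4 ^+ k * (side W k + side H k) ^+ 2 = D.
  rewrite /side -mulrDl expr_div_n -/D -exprM muln2 -addnn exprD.
  have -> : 4 ^+ k = 2 ^+ k * 2 ^+ k :> R by rewrite -exprMn -natrM.
  by field; rewrite gt_eqF.
have : `|E a b c d| <= 2 * (`|E a b c d| / (4 * (D + 1))) * D.
  by rewrite (le_trans le2) // -[X in _ <= _ * X]E4 mulrCA ler_wpM2l ?exprn_ge0.
have -> : 2 * (`|E a b c d| / (4 * (D + 1))) * D =
  `|E a b c d| * (D / (2 * (D + 1))) by field; lra.
rewrite -{1}[X in X <= _]mulr1 ler_pM2l // ler_pdivlMr; last by lra.
lra.
Qed.

End Goursat.

(** * First-order expansions *)

Lemma derivable_expansion (K : numFieldType) (V : normedModType K) (f : V -> K^o)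
  (a v : V) : derivable f a v -> forall e : K, 0 < e -> exists2 r : K, 0 < r &
  forall h : K, `|h| < r -> `|f (a + h *: v) - f a - h * 'D_v f a| <= e * `|h|.
Proof.
move=> df e e0.
move/cvgrPdist_le : (df : _ --> _) => /(_ e e0).
move=> /nbhs_ballP[r /= r0 hr]; exists r => // h hlt.
have [->|h0] := eqVneq h 0.
  by rewrite scale0r addr0 subrr mul0r subr0 normr0 mulr0.
have := hr h; rewrite /ball /= sub0r normrN => /(_ hlt h0).
rewrite /shift /= distrC => hh.
have -> : f (a + h *: v) - f a - h * 'D_v f a =
    h * (h^-1 *: (f (h *: v + a) - f a) - 'D_v f a).
  by rewrite /GRing.scale /= mulrBr mulrA mulfV // mul1r [a + _]addrC.
by rewrite normrM mulrC ler_wpM2r.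
Qed.

Lemma is_derive_expansion (R : realType) (f : R -> R) (a D : R) :
  is_derive a 1 f D -> forall e : R, 0 < e -> exists2 r : R, 0 < r &
  forall h, `|h| < r -> `|f (a + h) - f a - D * h| <= e * `|h|.
Proof.
move=> [df <-] e e0; have [r r0 hr] := derivable_expansion df e0.
by exists r => // h /hr; rewrite /GRing.scale /= mulr1 [h * _]mulrC.
Qed.

(** Keeps an error multiplied by [C] within [e]; [C] may vanish, hence the denominator [C + 1]. *)
Lemma small_factor (R : realFieldType) (C e : R) : 0 <= C -> 0 < e ->
  exists u, [/\ 0 < u, u <= 1 & u * C <= e].
Proof.
move=> C0 e0; have C1 : 0 < C + 1 by rewrite ltr_wpDl.
exists (Num.min 1 (e / (C + 1))); rewrite lt_min ltr01 divr_gt0 // ge_min lexx.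
split=> //; apply: (@le_trans _ _ (e / (C + 1) * C)).
  by rewrite ler_wpM2r // ge_min lexx orbT.
by rewrite mulrAC ler_pdivrMr // ler_wpM2l ?(ltW e0) // lerDl.
Qed.

Section CircleMeans.
Variable R : realType.
Implicit Types (G : R[i] -> R[i]) (z w : R[i]) (s t x y : R).

Definition cdiff G z := exists A : R[i], forall e : R, 0 < e ->
  exists2 r : R, 0 < r & forall h, nm h < r ->
  nm (G (z + h) - G z - A * h) <= e * nm h.

Lemma expi_expansion (e : R) : 0 < e -> exists2 r : R, 0 < r &
  forall x y, `|x| < r -> `|y| < r ->
  nm ((expR x)%:C%C * expi y - 1 - (x +i* y)%C) <= e * (`|x| + `|y|).
Proof.
(* The real and imaginary errors below add up to at most 4 e' |x| + 5 e' |y|, so [e / 8] leaves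
   room. *)
move=> e0; have [e' [e'0 e'1 e'e]] : exists e' : R, [/\ 0 < e', e' <= 1 & e' <= e / 8].
  exists (Num.min (e / 8) 1); rewrite !ge_min !lexx orbT lt_min ltr01 divr_gt0 //.
have [r1 r10 h1] := is_derive_expansion (is_derive_expR (0 : R)) e'0.
have [r2 r20 h2] := is_derive_expansion (is_derive_cos (0 : R)) e'0.
have [r3 r30 h3] := is_derive_expansion (is_derive_sin (0 : R)) e'0.
exists (Num.min (Num.min r1 e') (Num.min r2 r3)); first by rewrite !lt_min r10 r20 r30 e'0.
move=> x y; rewrite !lt_min => /andP[/andP[xr1 xe] _] /andP[/andP[_ ye] /andP[yr2 yr3]].
have {h1 xr1} := h1 x xr1; have {h2 yr2} := h2 y yr2; have {h3 yr3} := h3 y yr3.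
rewrite !add0r expR0 cos0 sin0 !subr0 oppr0 mul0r subr0 !mul1r.
set a := expR x; set b := cos y; set c := sin y => hc hb ha.
apply: le_trans (nm_le_ReIm _) _ => /=; rewrite -/a -/b -/c.
have eR : `|a * b - 0 * c - 1 - x| <= `|a - 1 - x| * 2 + `|x| * `|b - 1| + `|b - 1|.
  have -> : a * b - 0 * c - 1 - x =
    (a - 1 - x) * (1 + (b - 1)) + x * (b - 1) + (b - 1) by ring.
  rewrite (le_trans (ler_normD _ _)) // lerD2r (le_trans (ler_normD _ _)) //.
  rewrite !normrM lerD2r ler_wpM2l // (le_trans (ler_normD _ _)) // normr1.
  by rewrite lerD2l (le_trans hb) // -[leRHS]mulr1 ler_pM // ltW // (lt_le_trans ye).
have eI : `|a * c + 0 * b - 0 - y| <= `|a - 1 - x| * (`|c - y| + `|y|) +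
     `|x| * (`|c - y| + `|y|) + `|c - y|.
  have -> : a * c + 0 * b - 0 - y =
    (a - 1 - x) * ((c - y) + y) + x * ((c - y) + y) + (c - y) by ring.
  rewrite (le_trans (ler_normD _ _)) // lerD2r (le_trans (ler_normD _ _)) //.
  by rewrite !normrM lerD // ler_wpM2l // ler_normD.
have [ax ay] : 0 <= `|x| /\ 0 <= `|y| by split; exact: normr_ge0.
move: eR eI ha hb hc xe ye; set ua := `|a - 1 - x|.
set ub := `|b - 1|; set uc := `|c - y|; move: ax ay; set X := `|x|; set Y := `|y|.
have [ua0 ub0 uc0] : [/\ 0 <= ua, 0 <= ub & 0 <= uc] by split; exact: normr_ge0.
move=> X0 Y0 eR eI ha hb hc xe ye.
have p1 : X * ub <= e' * Y by rewrite (le_trans _ hb) // ler_piMl //; lra.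
have p2 : ua * (uc + Y) <= 2 * (e' * X).
  rewrite mulrC; apply: ler_pM => //; [by rewrite addr_ge0|].
  have : e' * Y <= Y by rewrite ler_piMl. lra.
have p3 : X * (uc + Y) <= 2 * (e' * Y).
  have : X * (uc + Y) <= e' * (2 * Y); last by lra.
  apply: ler_pM => //; [by rewrite addr_ge0|lra|].
  have : e' * Y <= Y by rewrite ler_piMl. lra.
have p4 : e' * X <= e / 8 * X by rewrite ler_wpM2r.
have p5 : e' * Y <= e / 8 * Y by rewrite ler_wpM2r.
have p6 : 0 <= e * X by rewrite mulr_ge0 // ltW.
have p7 : 0 <= e * Y by rewrite mulr_ge0 // ltW.
lra.
Qed.

(** Chain rule along w exp(s sigma + i t), with sigma = tau + i alpha and B = z G'(z). The
    derivatives in s and t are B sigma and B i: their fixed ratio is what makes the form in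
    [avg1_goursat] closed. *)
Lemma spiral_expansion G (w : R[i]) (tau alpha s0 t0 : R) :
  let z s t := w * ((expR (s * tau))%:C%C * expi (s * alpha + t)) in
  cdiff G (z s0 t0) ->
  exists B : R[i], forall e, 0 < e -> exists2 r, 0 < r &
    forall s t, `|s - s0| < r -> `|t - t0| < r ->
    nm (G (z s t) - G (z s0 t0)
        - B * ((tau +i* alpha)%C * (s - s0)%:C%C + (0 +i* 1)%C * (t - t0)%:C%C))
      <= e * (`|s - s0| + `|t - t0|).
Proof.
move=> z [A hA]; exists (A * z s0 t0) => e e0.
set z0 := z s0 t0; pose Z := nm z0; pose a := nm A.
have [Z0 a0] : 0 <= Z /\ 0 <= a by split; exact: nm_ge0.
pose K := `|tau| + `|alpha| + 1.
have K1 : 1 <= K by rewrite /K lerDr addr_ge0.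
have K0 : 0 < K by rewrite (lt_le_trans ltr01).
have e20 : 0 < e / 2 by rewrite divr_gt0.
have aZK0 : 0 <= a * Z * K by rewrite !mulr_ge0 // ltW.
have ZK0 : 0 <= Z * (2 * K) by rewrite !mulr_ge0 // ltW.
have [e1 [e10 e11 e1e]] := small_factor aZK0 e20.
have [e2 [e2p _ e2e]] := small_factor ZK0 e20.
have [r1 r10 h1] := hA e2 e2p; have [r2 r20 h2] := expi_expansion e10.
have ZK4 : 0 <= Z * (2 * K) * 4 by rewrite mulr_ge0.
have K4 : 0 <= K * 4 by rewrite mulr_ge0 // ltW.
have [u1 [u10 _ u1r]] := small_factor ZK4 r10.
have [u2 [u20 _ u2r]] := small_factor K4 r20.
exists (Num.min u1 u2); first by rewrite lt_min u10.
move=> s t; rewrite !lt_min => /andP[su1 su2] /andP[tu1 tu2].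
set ds := s - s0; set dt := t - t0.
pose x := ds * tau; pose y := ds * alpha + dt.
pose dlt := `|ds| + `|dt|.
have dlt0 : 0 <= dlt by rewrite addr_ge0.
have dlt1 : dlt <= u1 * 2 by rewrite mulr_natr mulr2n lerD // ltW.
have dlt2 : dlt <= u2 * 2 by rewrite mulr_natr mulr2n lerD // ltW.
have xyK : `|x| + `|y| <= K * dlt.
  rewrite /x /y /K /dlt normrM.
  have h3 : `|ds * alpha + dt| <= `|ds| * `|alpha| + `|dt| by rewrite -normrM ler_normD.
  have h4 : 0 <= `|tau| * `|dt| by rewrite mulr_ge0.
  have h5 : 0 <= `|alpha| * `|dt| by rewrite mulr_ge0.
  have h6 : 0 <= `|ds| by [].
  rewrite !mulrDl !mulrDr !mul1r (mulrC `|ds| `|tau|) (mulrC `|ds| `|alpha|) in h3 *.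
  lra.
have Kr2 : K * dlt < r2.
  have : K * dlt <= K * (u2 * 2) by rewrite ler_wpM2l // ltW.
  by move: u2r r20; lra.
have xr : `|x| < r2 by rewrite (le_lt_trans _ Kr2) // (le_trans _ xyK) // lerDl.
have yr : `|y| < r2 by rewrite (le_lt_trans _ Kr2) // (le_trans _ xyK) // lerDr.
pose h := z s t - z0.
have hE : h = z0 * ((expR x)%:C%C * expi y - 1).
  rewrite /h mulrBr mulr1 /z0 /z -mulrA; congr (w * _ - _).
  have -> : s * tau = s0 * tau + x by rewrite /x /ds; ring.
  have -> : s * alpha + t = s0 * alpha + t0 + y by rewrite /y /ds /dt; ring.
  by rewrite expRD expiD rmorphM mulrACA.
have xyE : (tau +i* alpha)%C * ds%:C%C + (0 +i* 1)%C * dt%:C%C = (x +i* y)%C.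
  by apply/eqP; rewrite eq_complex /= /x /y; apply/andP; split; apply/eqP; ring.
have hz : nm (h - z0 * (x +i* y)%C) <= Z * (e1 * (K * dlt)).
  rewrite hE -mulrBr nmM ler_wpM2l // (le_trans (h2 _ _ xr yr)) //.
  by rewrite ler_wpM2l // ltW.
have nxy : nm (x +i* y)%C <= K * dlt by rewrite (le_trans (nm_le_ReIm _)).
have hn : nm h <= Z * (2 * K) * dlt.
  rewrite -(subrK (z0 * (x +i* y)%C) h) (le_trans (nmD _ _)) //.
  apply: (@le_trans _ _ (Z * (K * dlt) + Z * (K * dlt))); last by lra.
  rewrite lerD //; last by rewrite nmM ler_wpM2l.
  rewrite (le_trans hz) // ler_wpM2l // ler_piMl // mulr_ge0 // ltW //.
have hr1 : nm h < r1.
  have : Z * (2 * K) * dlt <= Z * (2 * K) * (u1 * 2) by rewrite ler_wpM2l.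
  by move: u1r r10 hn; lra.
have zE : z s t = z0 + h by rewrite /h addrC subrK.
rewrite xyE zE.
have -> : G (z0 + h) - G z0 - A * z0 * (x +i* y)%C =
  (G (z0 + h) - G z0 - A * h) + A * (h - z0 * (x +i* y)%C) by ring.
rewrite (le_trans (nmD _ _)) // nmM -/a -/dlt.
have g1 := h1 h hr1.
have g2 : e2 * nm h <= e2 * (Z * (2 * K) * dlt) by rewrite ler_wpM2l // ltW.
have g3 : a * nm (h - z0 * (x +i* y)%C) <= a * (Z * (e1 * (K * dlt))).
  by rewrite ler_wpM2l.
have g4 : e2 * (Z * (2 * K)) * dlt <= e / 2 * dlt by rewrite ler_wpM2r.
have g5 : e1 * (a * Z * K) * dlt <= e / 2 * dlt by rewrite ler_wpM2r.
lra.
Qed.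

End CircleMeans.

(** * Goursat's lemma for averages over circles *)

Section GoursatCircle.
Variable R : realType.

Definition angle (N l : nat) : R := 2 * pi * l%:R / N%:R.

Lemma angleS N l : angle N l.+1 = angle N l + angle N 1.
Proof. by rewrite /angle -natr1; lra. Qed.

Lemma angle0 N : angle N 0 = 0.
Proof. by rewrite /angle mulr0 mul0r. Qed.

Lemma angle_full N : (0 < N)%N -> angle N N = 2 * pi.
Proof. by move=> N0; rewrite /angle mulfK // pnatr_eq0 -lt0n. Qed.

Lemma angle_ge0 N l : 0 <= angle N l.
Proof. by rewrite /angle !mulr_ge0 ?invr_ge0 // pi_ge0. Qed.

Lemma ler_angle N l m : (l <= m)%N -> angle N l <= angle N m.
Proof.
move=> lm; rewrite /angle ler_wpM2r ?invr_ge0 // ler_wpM2l ?ler_nat //.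
by rewrite mulr_ge0 // pi_ge0.
Qed.

Definition avg1 N (phi : R -> R[i]) : R[i] :=
  (N%:R^-1)%:C%C * \sum_(l < N) phi (angle N l).

Lemma continuous_on_segment_cst a b k : continuous_on_segment a b (fun=> k : R).
Proof. by move=> x _ e e0; exists 1 => // y _ _; rewrite subrr normr0. Qed.

Lemma segment_integral0 a b : segment_integral a b (fun=> 0 : R) = 0.
Proof. by rewrite /segment_integral /Rintegral integral0. Qed.

(** Induction on the number of grid cells: on each, [psi] stays within [eta] of its value at the
    left end, which costs [eta] times the length of the cell. *)
Lemma riemann_mean (psi : R -> R) N (eta : R) : (0 < N)%N ->
  continuous_on_segment 0 (2 * pi) psi ->
  (forall t t', `|t - t'| <= angle N 1 -> `|psi t - psi t'| <= eta) ->
  `|segment_integral 0 (2 * pi) psi - angle N 1 * \sum_(l < N) psi (angle N l)|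
    <= eta * (2 * pi).
Proof.
move=> N0 cpsi hpsi; rewrite -(angle_full N0).
suff H m : (m <= N)%N ->
    `|segment_integral 0 (angle N m) psi - angle N 1 * \sum_(l < m) psi (angle N l)|
    <= eta * angle N m by exact: (H N (leqnn N)).
elim: m => [_|m ih mN].
  rewrite big_ord0 mulr0 subr0 angle0 mulr0.
  have := @segment_integral_close R 0 0 psi (fun=> 0) 0 (`|psi 0|) (lexx _).
  rewrite !subr0 !mulr0 segment_integral0 !subr0; apply.
  - by apply: continuous_on_segmentS cpsi => //; rewrite mulr_ge0 // pi_ge0.
  - exact: continuous_on_segment_cst.
  - by move=> x; rewrite -eq_le => /eqP <-; rewrite !subr0.
have l1 : angle N m <= angle N m.+1 by exact: ler_angle.
have l2 : angle N m.+1 <= 2 * pi by rewrite -(angle_full N0) ler_angle.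
rewrite (@segment_integral_split _ 0 (angle N m)) ?angle_ge0 //; last first.
  exact: continuous_on_segmentS cpsi.
rewrite big_ord_recr /= mulrDr.
have := @segment_integral_close R (angle N m) (angle N m.+1) psi (fun=> 0)
  (psi (angle N m)) eta l1.
have -> : angle N m.+1 - angle N m = angle N 1 by rewrite angleS addrAC subrr add0r.
rewrite segment_integral0 subr0 => h.
have -> : forall a b c e : R, a + b - (c + e) = (a - c) + (b - e) by move=> *; ring.
rewrite (le_trans (ler_normD _ _)) // [X in _ <= _ * X]angleS mulrDr lerD ?ih ?(ltnW mN) //.
rewrite [angle N 1 * _]mulrC; apply: h.
- by apply: continuous_on_segmentS cpsi => //; rewrite angle_ge0.
- exact: continuous_on_segment_cst.
- move=> x /andP[x1 x2]; rewrite subr0; apply: hpsi.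
  by rewrite ger0_norm ?subr_ge0 // lerBlDr addrC -angleS.
Qed.

(* With [sigma = tau + i alpha], the path [s |-> w * exp (s * sigma)] is a spiral, so that
   changes of modulus and of argument are treated at once; on the rectangle of
   (s, t) the closed form is [G (- i sigma ds + dt)] at [w * exp (s * sigma + i t)]. *)
Lemma avg1_goursat (G : R[i] -> R[i]) (w : R[i]) (tau alpha : R) N (eta : R) :
  (0 < N)%N ->
  let lam := (expR tau)%:C%C * expi alpha in
  (forall s t, 0 <= s <= 1 ->
    cdiff G (w * ((expR (s * tau))%:C%C * expi (s * alpha + t)))) ->
  (forall t t', `|t - t'| <= angle N 1 ->
    nm (G (w * expi t) - G (w * expi t')) <= eta) ->
  (forall t t', `|t - t'| <= angle N 1 ->
    nm (G (w * lam * expi t) - G (w * lam * expi t')) <= eta) ->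
  nm (avg1 N (fun t => G (w * lam * expi t)) - avg1 N (fun t => G (w * expi t)))
    <= 4 * eta.
Proof.
move=> N0 lam Gd mod0 mod1.
pose H s t := G (w * ((expR (s * tau))%:C%C * expi (s * alpha + t))).
have H0 t : H 0 t = G (w * expi t) by rewrite /H !mul0r expR0 add0r mul1r.
have H1 t : H 1 t = G (w * lam * expi t) by rewrite /H !mul1r expiD !mulrA.
have Hper s : H s (2 * pi) = H s 0.
  by rewrite /H expiD -[2 * pi]mulr1 (expi_2pin _ 1) mulr1 addr0.
(* [goursat_rectangle] concerns real forms, so it is applied to real and imaginary parts; [L] stands
   for either, and each accounts for half of [4 * eta]. *)
suff main (L : R[i] -> R) : (forall x y, L (x + y) = L x + L y) ->
   (forall x, L (- x) = - L x) -> (forall t x, L (t%:C%C * x) = t * L x) ->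
   (forall x, `|L x| <= nm x) ->
   `|L (avg1 N (fun t => G (w * lam * expi t)) - avg1 N (fun t => G (w * expi t)))|
   <= 2 * eta.
  rewrite (le_trans (nm_le_ReIm _)) //.
  have -> : 4 * eta = 2 * eta + 2 * eta by ring.
  rewrite lerD //; apply: main.
  - exact: Re_D.
  - exact: Re_N.
  - by move=> t x; rewrite Re_M /= mul0r subr0.
  - exact: Re_le_nm.
  - exact: Im_D.
  - exact: Im_N.
  - by move=> t x; rewrite Im_M /= mul0r addr0.
  - exact: Im_le_nm.
move=> LD LN LZ Lnm.
have L0 : L 0 = 0 by have := LD 0 0; rewrite addr0; lra.
pose sigma := (tau +i* alpha)%C; pose ii : R[i] := (0 +i* 1)%C.
have ii2 : ii * ii = -1 by apply/eqP; rewrite eq_complex /= /ii; apply/andP; split; apply/eqP; ring.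
(* The factor - i sigma makes the form closed: the t-derivative of [P] is L(- i sigma B i) = L(B
   sigma), which is the s-derivative of [Q]. *)
pose Q s t := L (H s t); pose P s t := L (- ii * sigma * H s t).
have pi20 : 0 <= 2 * pi :> R by rewrite mulr_ge0 // pi_ge0.
have closed s0 t0 : 0 <= s0 <= 1 -> 0 <= t0 <= 2 * pi ->
  exists p1 p2 q2, forall e, 0 < e -> exists2 r, 0 < r &
    forall s t, 0 <= s <= 1 -> 0 <= t <= 2 * pi -> `|s - s0| < r -> `|t - t0| < r ->
    `|P s t - P s0 t0 - p1 * (s - s0) - p2 * (t - t0)|
       <= e * (`|s - s0| + `|t - t0|) /\
    `|Q s t - Q s0 t0 - p2 * (s - s0) - q2 * (t - t0)|
       <= e * (`|s - s0| + `|t - t0|).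
  move=> s01 _; have [B hB] := spiral_expansion (Gd s0 t0 s01).
  exists (L (- ii * sigma * (B * sigma))), (L (B * sigma)), (L (B * ii)) => e e0.
  have [e1 [e10 e11 e1e]] := small_factor (nm_ge0 (- ii * sigma)) e0.
  have m0 : 0 < Num.min e e1 by rewrite lt_min e0.
  have [r r0 hr] := hB _ m0; exists r => // s t _ _ sr tr.
  have := hr s t sr tr; rewrite -/(H s t) -/(H s0 t0) -/sigma -/ii.
  set Er := _ - B * _ => hEr.
  have dd : 0 <= `|s - s0| + `|t - t0| by rewrite addr_ge0.
  split.
    have -> : P s t - P s0 t0 - L (- ii * sigma * (B * sigma)) * (s - s0)
       - L (B * sigma) * (t - t0) = L (- ii * sigma * Er).
      rewrite /P ![L _ * _]mulrC -!LZ -!LN -!LD; congr L; rewrite /Er.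
      have -> : ((t - t0)%:C)%C * (B * sigma) =
        - (ii * ii) * (((t - t0)%:C)%C * (B * sigma)) by rewrite ii2 opprK mul1r.
      ring.
    rewrite (le_trans (Lnm _)) // nmM.
    apply: (@le_trans _ _ (nm (- ii * sigma) * (e1 * (`|s - s0| + `|t - t0|)))).
      rewrite ler_wpM2l ?nm_ge0 // (le_trans hEr) // ler_wpM2r //.
      by rewrite ge_min lexx orbT.
    by rewrite mulrA ler_wpM2r // mulrC.
  have -> : Q s t - Q s0 t0 - L (B * sigma) * (s - s0)
       - L (B * ii) * (t - t0) = L Er.
    rewrite /Q ![L _ * _]mulrC -!LZ -!LN -!LD; congr L; rewrite /Er; ring.
  rewrite (le_trans (Lnm _)) // (le_trans hEr) // ler_wpM2r //.
  by rewrite ge_min lexx.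
have cQ s : 0 <= s <= 1 -> continuous_on_segment 0 (2 * pi) (Q s).
  by move=> s01; apply: (closed_form_continuous closed).
have := goursat_rectangle ler01 pi20 closed.
(* The sides t = 0 and t = 2 pi cancel by periodicity, so the integrals at s = 0 and s = 1 agree.
   Each is then traded for its Riemann sum at the cost [eta * (2 * pi)]. *)
have -> : (P ^~ (2 * pi)) = (P ^~ 0) by apply/funext => s; rewrite /P Hper.
rewrite [X in X - _]addrAC subrr add0r => /eqP; rewrite subr_eq0 => /eqP I01.
have le01 : 0 <= (0 : R) <= 1 by rewrite lexx ler01.
have le11 : 0 <= (1 : R) <= 1 by rewrite lexx ler01.
have R0 := @riemann_mean (Q 0) N eta N0 (cQ _ le01).
have R1 := @riemann_mean (Q 1) N eta N0 (cQ _ le11).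
have {R0} R0 : `|segment_integral 0 (2 * pi) (Q 0) -
    angle N 1 * \sum_(l < N) Q 0 (angle N l)| <= eta * (2 * pi).
  by apply: R0 => t t' tt; rewrite /Q -LN -LD (le_trans (Lnm _)) // !H0 mod0.
have {R1} R1 : `|segment_integral 0 (2 * pi) (Q 1) -
    angle N 1 * \sum_(l < N) Q 1 (angle N l)| <= eta * (2 * pi).
  by apply: R1 => t t' tt; rewrite /Q -LN -LD (le_trans (Lnm _)) // !H1 mod1.
have Lsum (F : 'I_N -> R[i]) : L (\sum_(l < N) F l) = \sum_(l < N) L (F l).
  exact: (big_morph L LD L0).
have -> : L (avg1 N (fun t => G (w * lam * expi t)) - avg1 N (fun t => G (w * expi t)))
  = N%:R^-1 * (\sum_(l < N) Q 1 (angle N l) - \sum_(l < N) Q 0 (angle N l)).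
  rewrite /avg1 LD LN !LZ !Lsum mulrBr; congr (_ * _ - _ * _).
    by apply: eq_bigr => l _; rewrite /Q H1.
  by apply: eq_bigr => l _; rewrite /Q H0.
have pi2 : 0 < 2 * pi :> R by rewrite mulr_gt0 // pi_gt0.
rewrite -(ler_pM2l pi2) -[X in X * `|_|](ger0_norm pi20) -normrM.
have -> : forall a b : R, 2 * pi * (N%:R^-1 * (a - b)) = angle N 1 * a - angle N 1 * b.
  by move=> x y; rewrite /angle; ring.
rewrite -(subrK (segment_integral 0 (2 * pi) (Q 1)) (angle N 1 * _)) {2}I01 -addrA.
rewrite (le_trans (ler_normD _ _)) //.
have -> : 2 * pi * (2 * eta) = eta * (2 * pi) + eta * (2 * pi) by ring.
by rewrite lerD // distrC.
Qed.

End GoursatCircle.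

(** * Discrete means over the torus *)

Section TorusMeans.
Variables (R : realType) (n : nat).
Implicit Types (phi psi : ('I_n -> R) -> R[i]) (th : 'I_n -> R) (mu nu : 'rV[int]_n).

Definition grid N (k : {ffun 'I_n -> 'I_N}) : 'I_n -> R := fun j => angle R N (k j).

Definition avg N phi : R[i] :=
  ((N%:R^-1 ^+ n)%:C)%C * \sum_(k : {ffun 'I_n -> 'I_N}) phi (grid k).

Lemma eq_avg N phi psi : (forall th, phi th = psi th) -> avg N phi = avg N psi.
Proof. by move=> h; congr avg; apply/funext. Qed.

Lemma avgZ N c phi : avg N (fun th => c * phi th) = c * avg N phi.
Proof. by rewrite /avg -mulr_sumr mulrCA. Qed.

Lemma avgB N phi psi : avg N (fun th => phi th - psi th) = avg N phi - avg N psi.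
Proof. by rewrite /avg sumrB mulrBr. Qed.

Lemma avg_sum (I : Type) (r : seq I) (P : pred I) (F : I -> ('I_n -> R) -> R[i]) N :
  avg N (fun th => \sum_(i <- r | P i) F i th) = \sum_(i <- r | P i) avg N (F i).
Proof. by rewrite /avg exchange_big mulr_sumr. Qed.

Lemma avg_weight_sum N (c : R) : (0 < N)%N ->
  N%:R^-1 ^+ n * (\sum_(k : {ffun 'I_n -> 'I_N}) c) = c.
Proof.
move=> N0; rewrite sumr_const card_ffun !card_ord -[c *+ _]mulr_natl mulrA natrX.
by rewrite exprVn mulVf ?mul1r // expf_neq0 // pnatr_eq0 -lt0n.
Qed.

Lemma nm_avg_le N phi M : (0 < N)%N ->
  (forall k : {ffun 'I_n -> 'I_N}, nm (phi (grid k)) <= M) -> nm (avg N phi) <= M.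
Proof.
move=> N0 h; have w0 : 0 <= N%:R^-1 ^+ n :> R by rewrite exprn_ge0 // invr_ge0.
rewrite nmM nm_real ger0_norm // -[leRHS](avg_weight_sum M N0).
by rewrite ler_wpM2l // (le_trans (nm_sum _ _ _)) // ler_sum.
Qed.

Lemma avg_prod N (psi : 'I_n -> R -> R[i]) :
  avg N (fun th => \prod_j psi j (th j)) = \prod_j avg1 N (psi j).
Proof.
rewrite /avg /avg1 big_split /= prodr_const card_ord rmorphXn; congr (_ * _).
by rewrite bigA_distr_bigA.
Qed.

Definition chi mu th : R[i] := \prod_j expi (th j) ^ (mu 0 j).

Lemma chi0 th : chi 0 th = 1.
Proof. by rewrite /chi big1 // => j _; rewrite mxE expr0z. Qed.

Lemma chiD mu nu th : chi (mu + nu) th = chi mu th * chi nu th.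
Proof.
by rewrite /chi -big_split; apply: eq_bigr => j _; rewrite mxE expfzDr // expi_neq0.
Qed.

Lemma nm_chi mu th : nm (chi mu th) = 1.
Proof. by rewrite /chi nm_prod big1 // => j _; rewrite nm_exprz nm_expi exp1rz. Qed.

Lemma expi_neq1 (t : R) : 0 < t < 2 * pi -> expi t != 1.
Proof.
move=> /andP[t0 t2]; apply/eqP => h.
have s0 : 0 < sin (t / 2) by apply: sin_gt0_pi; rewrite divr_gt0 // ltr_pdivrMr // mulrC t2.
have : cos t = 1 by have := congr1 (@complex.Re R) h.
have {1}-> : t = (t / 2) *+ 2 by rewrite -[_ *+ 2]mulr_natr divfK.
rewrite cos_mulr2n cos2sin2 => h1.
have : 0 < sin (t / 2) ^+ 2 by rewrite exprn_gt0.
lra.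
Qed.

(** A geometric sum whose ratio is an N-th root of unity; [|m| < N] excludes the ratio 1, so a grid
    finer than the frequency sees no aliasing. *)
Lemma avg1_expi_eq0 N (m : int) : (0 < `|m| < N)%N ->
  avg1 N (fun t => expi t ^ m) = 0 :> R[i].
Proof.
move=> /andP[m0 mN]; have N0 : (0 < N)%N by rewrite (leq_trans _ mN).
have NR : 0 < N%:R :> R by rewrite ltr0n.
pose q : R[i] := expi (angle R N 1) ^ m.
have qE (l : nat) : expi (angle R N l) ^ m = q ^+ l.
  rewrite /q -!expi_int -expi_nat; congr expi; rewrite /angle; ring.
have qN : q ^+ N = 1 by rewrite -qE angle_full // -expi_int expi_2pi.
have key : expi (angle R N `|m|%N) != 1.
  apply: expi_neq1; apply/andP; split.
    by rewrite /angle !mulr_gt0 ?invr_gt0 ?ltr0n // pi_gt0.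
  rewrite /angle ltr_pdivrMr // ltr_pM2l ?ltr_nat //.
  by rewrite mulr_gt0 // pi_gt0.
have q1 : q != 1.
  have aE : expi (angle R N `|m|%N) = expi (angle R N 1) ^ (`|m|%N : int).
    by rewrite -expi_int; congr expi; rewrite /angle -pmulrn; ring.
  move: key; rewrite aE /q; case: (intP m) => [|k|k]; [by rewrite expr0z|by []|].
  rewrite abszN => h; rewrite -invr_expz; apply: contra h => /eqP h.
  by rewrite -[expi _ ^ _]invrK h invr1.
have S0 : \sum_(l < N) q ^+ l = 0.
  have := subrX1 q N; rewrite qN subrr => /esym/eqP.
  by rewrite mulf_eq0 subr_eq0 (negbTE q1) /= => /eqP.
by rewrite /avg1 (eq_bigr (fun l : 'I_N => q ^+ l)) ?S0 ?mulr0 // => l _; rewrite qE.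
Qed.

Lemma avg1_cst N : (0 < N)%N -> avg1 N (fun=> 1) = 1 :> R[i].
Proof.
move=> N0; rewrite /avg1 sumr_const card_ord -(rmorph_nat (real_complex R)) -rmorphM.
by rewrite mulVf ?pnatr_eq0 -?lt0n.
Qed.

Lemma avg_chi N mu : avg N (chi mu) = \prod_j avg1 N (fun t => expi t ^ (mu 0 j)).
Proof. exact: (avg_prod N (fun j t => expi t ^ (mu 0 j))). Qed.

Lemma avg_chi_eq0 N mu : mu != 0 -> (forall j, (`|mu 0%R j| < N)%N) -> avg N (chi mu) = 0.
Proof.
move=> mu0 muN; rewrite avg_chi; have [j muj] : exists j, mu 0 j != 0.
  apply/existsP; apply: contraNT mu0 => /existsPn h; apply/eqP/rowP => j.
  by rewrite mxE; apply/eqP; have := h j; rewrite negbK.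
rewrite (bigD1 j) //= avg1_expi_eq0 ?mul0r // muN andbT lt0n.
by rewrite absz_eq0.
Qed.

Lemma avg_chi0 N : (0 < N)%N -> avg N (chi 0) = 1.
Proof.
move=> N0; rewrite avg_chi big1 // => j _.
by rewrite -[RHS](avg1_cst N0); congr avg1; apply/funext => t; rewrite mxE expr0z.
Qed.

Definition upd th j t : 'I_n -> R := fun i => if i == j then t else th i.

(* The map (k, l) -> (k with entry j replaced by l, k j) is an involution. *)
Lemma avg_coord N phi (j : 'I_n) : (0 < N)%N ->
  avg N phi = avg N (fun th => avg1 N (fun t => phi (upd th j t))).
Proof.
move=> N0; rewrite /avg; congr (_ * _).
pose setj (k : {ffun 'I_n -> 'I_N}) (l : 'I_N) :=
  [ffun i => if i == j then l else k i].
pose swap (kl : {ffun 'I_n -> 'I_N} * 'I_N) := (setj kl.1 kl.2, kl.1 j).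
have swapK : involutive swap.
  move=> [k l]; rewrite /swap /=; congr (_, _); last by rewrite ffunE eqxx.
  by apply/ffunP => i; rewrite !ffunE; case: eqP => // ->.
have -> : \sum_(k : {ffun 'I_n -> 'I_N}) avg1 N (fun t => phi (upd (grid k) j t)) =
  (N%:R^-1)%:C%C * \sum_(kl : {ffun 'I_n -> 'I_N} * 'I_N) phi (grid (swap kl).1).
  rewrite /avg1 -mulr_sumr pair_big /=; congr (_ * _).
  apply: eq_bigr => kl _; congr phi; apply/funext => i.
  by rewrite /upd /grid ffunE; case: eqP.
rewrite -(reindex_inj (h := swap) (P := xpredT) (F := fun kl => phi (grid kl.1))) /=; last first.
  exact: inv_inj swapK.
rewrite -(pair_big xpredT xpredT (fun k _ => phi (grid k))) /= mulr_sumr.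
apply: eq_bigr => k _; rewrite sumr_const card_ord -[phi _ *+ _]mulr_natl mulrA.
rewrite -(rmorph_nat (real_complex R)) -rmorphM mulVf ?mul1r //.
by rewrite pnatr_eq0 -lt0n.
Qed.

End TorusMeans.

(** * Limits of complex sequences *)

Section ComplexLimits.
Variable R : realType.
Implicit Types (u v : nat -> R[i]) (L : R[i]).

Definition ctends u L := forall e : R, 0 < e ->
  exists N0, forall N, (N0 <= N)%N -> nm (u N - L) <= e.

Lemma ctends_cst L : ctends (fun=> L) L.
Proof. by move=> e e0; exists 0%N => N _; rewrite subrr nm0 ltW. Qed.

Lemma ctendsD u v L (M : R[i]) : ctends u L -> ctends v M -> ctends (fun N => u N + v N) (L + M).
Proof.
move=> uL vM e e0; have e20 : 0 < e / 2 by rewrite divr_gt0.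
have [N1 h1] := uL _ e20; have [N2 h2] := vM _ e20.
exists (maxn N1 N2) => N; rewrite geq_max => /andP[/h1 {}h1 /h2 {}h2].
have -> : u N + v N - (L + M) = (u N - L) + (v N - M) by ring.
by rewrite (le_trans (nmD _ _)) // [leRHS]splitr lerD.
Qed.

Lemma ctendsZ c u L : ctends u L -> ctends (fun N => c * u N) (c * L).
Proof.
move=> uL e e0; have [d [d0 _ dc]] := small_factor (nm_ge0 c) e0.
have [N0 h] := uL _ d0; exists N0 => N /h {}h.
by rewrite -mulrBr nmM (le_trans _ dc) // mulrC ler_wpM2r // nm_ge0.
Qed.

Lemma ctendsB u v L (M : R[i]) : ctends u L -> ctends v M -> ctends (fun N => u N - v N) (L - M).
Proof.
move=> uL /(ctendsZ (-1)) vM; rewrite -mulN1r.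
have -> : (fun N => u N - v N) = (fun N => u N + -1 * v N).
  by apply/funext => N; rewrite mulN1r.
exact: ctendsD.
Qed.

Lemma ctends_sum (I : Type) (r : seq I) (F : I -> nat -> R[i]) (G : I -> R[i]) :
  (forall i, ctends (F i) (G i)) ->
  ctends (fun N => \sum_(i <- r) F i N) (\sum_(i <- r) G i).
Proof.
move=> FG; elim: r => [|i r ih].
  rewrite big_nil (_ : (fun N => _) = fun=> 0); first exact: ctends_cst.
  by apply/funext => N; rewrite big_nil.
rewrite big_cons (_ : (fun N => _) = fun N => F i N + \sum_(j <- r) F j N).
  exact: ctendsD.
by apply/funext => N; rewrite big_cons.
Qed.

Lemma ctends_near u v L : (exists N0, forall N, (N0 <= N)%N -> u N = v N) ->
  ctends u L -> ctends v L.
Proof.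
move=> [N0 uv] uL e e0; have [N1 h] := uL e e0.
by exists (maxn N0 N1) => N; rewrite geq_max => /andP[/uv <- /h].
Qed.

Lemma ctends_nm_le u L (M : R) : (exists N0, forall N, (N0 <= N)%N -> nm (u N) <= M) ->
  ctends u L -> nm L <= M.
Proof.
move=> [N0 uM] uL; apply/ler_addgt0Pr => e e0; have [N1 h] := uL e e0.
have h1 := h _ (leq_maxr N0 N1); have h2 := uM _ (leq_maxl N0 N1).
rewrite -[L](subrK (u (maxn N0 N1))) addrC (le_trans (nmD _ _)) // lerD //.
by rewrite nmB.
Qed.

Lemma ctends_unique u L (M : R[i]) : ctends u L -> ctends u M -> L = M.
Proof.
move=> uL uM; apply/eqP; rewrite -subr_eq0 -nm_eq0 eq_le nm_ge0 andbT.
apply: ctends_nm_le (ctendsB uL uM).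
by exists 0%N => N _; rewrite subrr nm0.
Qed.

Lemma ctends_Re u L : ctends u L ->
  ((fun N => complex.Re (u N)) @ \oo --> complex.Re L)%classic.
Proof.
move=> uL; apply/cvgrPdist_le => e e0; have [N0 h] := uL e e0.
exists N0 => // N /= /h; apply: le_trans.
by rewrite distrC -Re_N -Re_D Re_le_nm.
Qed.

Lemma ctends_Im u L : ctends u L ->
  ((fun N => complex.Im (u N)) @ \oo --> complex.Im L)%classic.
Proof.
move=> uL; apply/cvgrPdist_le => e e0; have [N0 h] := uL e e0.
exists N0 => // N /= /h; apply: le_trans.
by rewrite distrC -Im_N -Im_D Im_le_nm.
Qed.

Lemma cauchy_real_limit (x : nat -> R) :
  (forall e, 0 < e -> exists N0, forall N M, (N0 <= N)%N -> (N0 <= M)%N ->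
    `|x N - x M| <= e) ->
  exists l, forall e, 0 < e -> exists N0, forall N, (N0 <= N)%N -> `|x N - l| <= e.
Proof.
move=> cx; have /cvg_ex[l hl] : cvg (x @ \oo)%classic.
  apply: cauchy_cvg; apply: cauchy_exP => e e0.
  have e20 : 0 < e / 2 by rewrite divr_gt0.
  have [N0 h] := cx _ e20; exists (x N0); exists N0 => // N /= N0N.
  by rewrite /ball /= (le_lt_trans (h _ _ (leqnn _) N0N)) // ltr_pdivrMr // mulr_natr mulr2n ltrDl.
exists l => e e0; move/cvgrPdist_le : hl => /(_ e e0)[N0 _ h].
by exists N0 => N N0N; rewrite distrC; exact: h.
Qed.

Lemma ctends_cauchy u :
  (forall e, 0 < e -> exists N0, forall N M, (N0 <= N)%N -> (N0 <= M)%N ->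
    nm (u N - u M) <= e) -> exists L, ctends u L.
Proof.
move=> cu; have [a ha] : exists l, forall e, 0 < e -> exists N0, forall N,
    (N0 <= N)%N -> `|complex.Re (u N) - l| <= e.
  apply: cauchy_real_limit => e e0; have [N0 h] := cu e e0; exists N0 => N M hN hM.
  by rewrite -Re_N -Re_D (le_trans (Re_le_nm _)) // h.
have [b hb] : exists l, forall e, 0 < e -> exists N0, forall N,
    (N0 <= N)%N -> `|complex.Im (u N) - l| <= e.
  apply: cauchy_real_limit => e e0; have [N0 h] := cu e e0; exists N0 => N M hN hM.
  by rewrite -Im_N -Im_D (le_trans (Im_le_nm _)) // h.
exists (a +i* b)%C => e e0; have e20 : 0 < e / 2 by rewrite divr_gt0.
have [N1 h1] := ha _ e20; have [N2 h2] := hb _ e20.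
exists (maxn N1 N2) => N; rewrite geq_max => /andP[/h1 {}h1 /h2 {}h2].
by rewrite (le_trans (nm_le_ReIm _)) // [leRHS]splitr !Re_D !Im_D !Re_N !Im_N lerD.
Qed.

End ComplexLimits.

(** * Convergence of grid averages *)

Section MeanLimits.
Variables (R : realType) (n : nat).
Implicit Types phi : ('I_n -> R) -> R[i].

Definition uniformly_continuous_torus phi := forall e : R, 0 < e ->
  exists2 d : R, 0 < d & forall th th', (forall j, `|th j - th' j| <= d) ->
  nm (phi th - phi th') <= e.

(** Writing a fine index as a K + b splits the fine grid into K^n translates of the coarse one, each
    shifted by at most one coarse step in every coordinate. *)
Lemma avg_refine N K phi (eta : R) : (0 < N)%N -> (0 < K)%N ->
  (forall th th', (forall j, `|th j - th' j| <= angle R N 1) ->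
     nm (phi th - phi th') <= eta) ->
  nm (avg N phi - avg (N * K) phi) <= eta.
Proof.
move=> N0 K0 hphi.
have lt_NK (a : 'I_N) (b : 'I_K) : (a * K + b < N * K)%N.
  rewrite (@leq_trans (a * K + K)) // ?ltn_add2l //.
  by rewrite -mulSnr leq_mul2r ltn_ord orbT.
have div_lt (k : 'I_(N * K)) : (k %/ K < N)%N by rewrite ltn_divLR.
have mod_lt (k : 'I_(N * K)) : (k %% K < K)%N by rewrite ltn_mod.
pose join (ab : {ffun 'I_n -> 'I_N} * {ffun 'I_n -> 'I_K}) :
  {ffun 'I_n -> 'I_(N * K)} := [ffun j => Ordinal (lt_NK (ab.1 j) (ab.2 j))].
pose unjoin (k : {ffun 'I_n -> 'I_(N * K)}) :=
  ([ffun j => Ordinal (div_lt (k j))], [ffun j => Ordinal (mod_lt (k j))]).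
have joinK : cancel join unjoin.
  move=> [a b]; rewrite /unjoin /join /=; congr (_, _); apply/ffunP => j;
  rewrite !ffunE; apply: val_inj => /=.
    by rewrite divnMDl // divn_small ?addn0.
  by rewrite modnMDl modn_small.
have unjoinK : cancel unjoin join.
  by move=> k; apply/ffunP => j; apply: val_inj; rewrite !ffunE /= -divn_eq.
have KR : K%:R != 0 :> R by rewrite pnatr_eq0 -lt0n.
have NR : N%:R != 0 :> R by rewrite pnatr_eq0 -lt0n.
have avgNK : avg (N * K) phi =
  ((K%:R^-1 ^+ n)%:C)%C * \sum_(b : {ffun 'I_n -> 'I_K})
    avg N (fun th => phi (fun j => th j + angle R (N * K) (b j))).
  rewrite {1}/avg (reindex join) /=; last by exists unjoin => x _.
  rewrite -(pair_big xpredT xpredT (fun a b => phi (grid R (join (a, b))))) /= exchange_big /=.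
  rewrite /avg -mulr_sumr mulrA -rmorphM -exprMn natrM invfM mulrC [K%:R^-1 * _]mulrC mulrC.
  congr (_ * _); apply: eq_bigr => b _; apply: eq_bigr => a _.
  congr phi; apply/funext => j; rewrite /grid /angle ffunE /= natrD !natrM.
  by field; rewrite NR KR.
have avgN : avg N phi =
  ((K%:R^-1 ^+ n)%:C)%C * \sum_(b : {ffun 'I_n -> 'I_K}) avg N phi.
  rewrite sumr_const card_ffun !card_ord -[avg N phi *+ _]mulr_natl mulrA natrX.
  rewrite -(rmorph_nat (real_complex R)) -rmorphXn -rmorphM -exprMn mulVf //.
  by rewrite expr1n mul1r.
have w0 : 0 <= K%:R^-1 ^+ n :> R by rewrite exprn_ge0 // invr_ge0.
rewrite avgNK [in X in X - _]avgN -mulrBr -sumrB nmM nm_real ger0_norm //.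
rewrite -[leRHS](avg_weight_sum n eta K0) ler_wpM2l // (le_trans (nm_sum _ _ _)) //.
apply: ler_sum => b _; rewrite -avgB; apply: nm_avg_le => // k; apply: hphi => j.
rewrite opprD addNKr normrN ger0_norm ?angle_ge0 //.
have -> : angle R N 1 = angle R (N * K) K.
  by rewrite /angle natrM; field; rewrite NR KR.
exact/ler_angle/ltnW.
Qed.

Lemma angle_small (d : R) : 0 < d ->
  exists N0, forall N, (N0 <= N)%N -> angle R N.+1 1 <= d.
Proof.
move=> d0; have p0 : 0 <= 2 * pi / d by rewrite divr_ge0 ?mulr_ge0 ?pi_ge0 // ltW.
exists (Num.bound (2 * pi / d)) => N h; rewrite /angle mulr1 ler_pdivrMr ?ltr0n //.
rewrite [d * _]mulrC -ler_pdivrMr // (le_trans (ltW (archi_boundP p0))) // ler_nat.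
exact: leqW.
Qed.

(** Cauchy's criterion: two grids are compared through their common refinement, of order the
    product. The successor [N.+1] keeps the grids nonempty. *)
Lemma avg_limit phi : uniformly_continuous_torus phi ->
  exists L, ctends (fun N => avg N.+1 phi) L.
Proof.
move=> uphi; apply: ctends_cauchy => e e0.
have e20 : 0 < e / 2 by rewrite divr_gt0.
have [d d0 hd] := uphi _ e20; have [N0 hN0] := angle_small d0.
exists N0 => N M hN hM.
have ref m p : (N0 <= m)%N -> nm (avg m.+1 phi - avg (m.+1 * p.+1) phi) <= e / 2.
  move=> hm; apply: avg_refine => // th th' h; apply: hd => j.
  by rewrite (le_trans (h j)) // hN0.
have h1 := ref N M hN; have h2 := ref M N hM.
rewrite (le_trans (nm_dist (avg (N.+1 * M.+1) phi) _ _)) // [leRHS]splitr lerD //.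
by rewrite nmB mulnC.
Qed.

End MeanLimits.

(** * Coordinatewise topology of C^n *)

Section CoordinateTopology.
Variables (R : realType) (n : nat).
Local Notation V := 'rV[R[i]^o]_n.
Implicit Types (z : V) (U K : set V).

(** The balls of this space have radii in [R[i]]; [close] describes the same topology by real
    radii. *)
Definition close (d : R) z z' := forall j, nm (z' 0 j - z 0 j) < d.

Lemma posc_Re (e : R[i]) : 0 < e -> 0 < complex.Re e /\ e = (complex.Re e)%:C%C.
Proof.
by case: e => a b; rewrite ltcE /= => /andP[/eqP -> a0].
Qed.

Lemma close_ball (e : R[i]) z z' : 0 < e -> close (complex.Re e) z z' -> ball z e z'.
Proof.
move=> e0; have [e1 eE] := posc_Re e0 => h; split=> // i j.
rewrite ord1 /ball /= normrE_nm nmB {1}eE ltcR.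
exact: h.
Qed.

Lemma near_close (d : R) z : 0 < d -> \forall z' \near z, close d z z'.
Proof.
move=> d0; apply/nbhs_ballP; exists (d%:C)%C; first by rewrite /= ltcR.
move=> z' [_ h] j; have := h 0 j; rewrite /ball /= normrE_nm ltcR.
by rewrite nmB.
Qed.

Lemma open_close U z : open U -> U z -> exists2 d, 0 < d & forall z', close d z z' -> U z'.
Proof.
move=> oU Uz; have /nbhs_ballP[e /= e0 h] := open_nbhs_nbhs (conj oU Uz).
exists (complex.Re e); first exact: (posc_Re e0).1.
by move=> z' zz'; apply: h; apply: close_ball.
Qed.

Lemma close_open U : (forall z, U z -> exists2 d, 0 < d & forall z', close d z z' -> U z') ->
  open U.
Proof.
move=> h; rewrite openE => z Uz; have [d d0 hd] := h z Uz.
exact: filterS (near_close z d0).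
Qed.

Lemma differentiable_close (g : V -> R[i]^o) z (e : R) : differentiable g z -> 0 < e ->
  exists2 d, 0 < d & forall z', close d z z' -> nm (g z' - g z) < e.
Proof.
move=> /differentiable_continuous /cvgrPdist_lt /(_ (e%:C)%C) h e0.
have {h} /nbhs_ballP[d /= d0 h] : \forall t \near z, `|g z - g t| < (e%:C)%C.
  by apply: h; rewrite ltcR.
exists (complex.Re d); first exact: (posc_Re d0).1.
by move=> z' /(close_ball d0) /h /=; rewrite normrE_nm ltcR nmB.
Qed.

Definition setc z j (w : R[i]) : V := \row_i if i == j then w else z 0 i.

Lemma setc_shift z j w h : setc z j w + h *: delta_mx 0 j = setc z j (w + h).
Proof.
apply/rowP => i; rewrite !mxE eqxx /=; case: eqP => _; rewrite /GRing.scale /= ?mulr1 ?mulr0 //.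
by rewrite addr0.
Qed.

Lemma derivable_slice (g : V -> R[i]^o) z j (w : R[i]^o) :
  differentiable g (setc z j w) -> derivable (fun h : R[i]^o => g (setc z j h)) w 1.
Proof.
move=> /(@diff_derivable _ _ _ _ _ (delta_mx 0 j)); rewrite /derivable /=.
set F := fun h : _ => _; set G := fun h : _ => _; suff -> : F = G by [].
rewrite /F /G; apply/funext => h; congr (_ *: (g _ - _)).
by rewrite /shift /= addrC setc_shift /GRing.scale /= mulr1 addrC.
Qed.

Lemma derivable_cdiff (G : R[i]^o -> R[i]^o) (w : R[i]^o) : derivable G w 1 -> cdiff G w.
Proof.
move=> dG; exists ('D_1 G w) => e e0.
have [|r r0 hr] := derivable_expansion dG (e := (e%:C)%C); first by rewrite ltcR.
have [r1 rE] := posc_Re r0; exists (complex.Re r) => // h hlt.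
have := hr h; rewrite [h *: _]mulr1 [`|h|]normrE_nm {1}rE ltcR => /(_ hlt).
by rewrite normrE_nm -rmorphM lecR [h * _]mulrC.
Qed.

Lemma derivable_exprz (k : int) (w : R[i]^o) : w != 0 ->
  derivable (fun h : R[i]^o => (h : R[i]) ^ k : R[i]^o) w 1.
Proof.
move=> w0; case: k => k; first exact: exprn_derivable.
apply: (@derivableV _ _ (fun h : R[i]^o => h ^+ k.+1)); first by rewrite expf_neq0.
exact: exprn_derivable.
Qed.

(** The one use of covers: continuity, boundedness and term estimates are each encoded as a property
    indexed by a natural number that holds locally from some index on, and compactness makes the
    index uniform. *)
Lemma compact_uniform K (P : nat -> V -> Prop) : compact K ->
  (forall z, K z -> exists2 d, 0 < d & exists m, forall z' i,
     close d z z' -> (m <= i)%N -> P i z') ->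
  exists m, forall z, K z -> P m z.
Proof.
move=> /compact_near_coveringP cK hP.
have [m _ hm] : \forall i \near \oo, K `<=` P i.
  apply: cK => z Kz; have [d d0 [m hm]] := hP z Kz.
  exists ([set z' | close d z z'], [set i | (m <= i)%N]) => /=.
    by split; [exact: near_close|exists m].
  by move=> [z' i] /= [h1 h2]; exact: hm.
by exists m => z Kz; exact: (hm m (leqnn m) z Kz).
Qed.

Lemma continuous_complex : continuous (fun p : R * R => (p.1 +i* p.2)%C : R[i]^o).
Proof.
move=> p; apply/cvgrPdist_lt => e e0; have [e1 eE] := posc_Re e0.
have e20 : 0 < complex.Re e / 2 by rewrite divr_gt0.
exists (ball p.1 (complex.Re e / 2), ball p.2 (complex.Re e / 2)).
  by split; exact: nbhsx_ballx.
move=> q [/= h1 h2]; rewrite normrE_nm eE ltcR.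
by rewrite (le_lt_trans (nm_le_ReIm _)) //= [ltRHS]splitr ltrD.
Qed.

Lemma ler_dist_nm (x y : R[i]) : `|nm x - nm y| <= nm (x - y).
Proof.
rewrite ler_norml lerBlDr -{3}[x](subrK y) nmD andbT.
by rewrite lerNl opprB lerBlDr nmB -{1}[y](subrK x) nmD.
Qed.

Lemma continuous_nm : continuous (fun w : R[i]^o => nm w : R).
Proof.
move=> w; have FF : Filter (nbhs w) by exact: nbhs_filter.
apply: (@cvgrPdist_lt R R R[i]^o (nbhs w) FF _ _).2 => e e0.
apply/nbhs_ballP; exists (e%:C)%C; first by rewrite /= ltcR.
move=> w'; rewrite /ball /= normrE_nm ltcR; apply: le_lt_trans.
exact: ler_dist_nm.
Qed.

Lemma compact_annulus (a b : R) : compact [set w : R[i]^o | a <= nm w <= b].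
Proof.
have cS : compact ((fun p : R * R => (p.1 +i* p.2)%C : R[i]^o) @`
    (`[- b, b]%classic `*` `[- b, b]%classic)).
  apply: continuous_compact; first by apply: continuous_subspaceT; exact: continuous_complex.
  by apply: compact_setX; exact: segment_compact.
apply: subclosed_compact cS _; last first.
  move=> w /= /andP[_ wb]; exists (complex.Re w, complex.Im w); last by case: w wb.
  rewrite /= !in_itv /= -!ler_norml.
  by rewrite (le_trans (Re_le_nm _)) ?(le_trans (Im_le_nm _)).
have -> : [set w : R[i]^o | a <= nm w <= b] = (fun w : R[i]^o => nm w) @^-1` `[a, b]%classic.
  by apply/seteqP; split => w /=; rewrite in_itv.
by apply: preimage_closed; [move=> w _; exact: continuous_nm|exact: interval_closed].
Qed.

Lemma compact_polyannulus (a b : 'I_n -> R) :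
  compact [set z : V | forall j, a j <= nm (z 0 j) <= b j].
Proof.
apply: (@rV_compact R[i]^o n (fun j => [set w : R[i]^o | a j <= nm w <= b j])) => j.
exact: compact_annulus.
Qed.

End CoordinateTopology.

(** * Fourier coefficients on tori *)

Section TorusFourier.
Variables (R : realType) (n : nat).
Local Notation V := 'rV[R[i]^o]_n.
Implicit Types (z : V) (nu : 'rV[int]_n) (th : 'I_n -> R).

Definition rot th z : V := \row_j (expi (th j) * z 0 j).

Lemma chi_expi nu th : chi nu th = expi (\sum_j th j * (nu 0 j)%:~R).
Proof.
rewrite (big_morph (@expi R) (@expiD R) (@expi0 R)) /chi.
by apply: eq_bigr => j _; rewrite expi_int.
Qed.

Lemma expi_uniform (e : R) : 0 < e -> exists2 d : R, 0 < d &
  forall t t', `|t - t'| <= d -> nm (expi t - expi t') <= e.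
Proof.
move=> e0; have [r r0 hr] := expi_expansion (@ltr01 R).
exists (Num.min (r / 2) (e / 2)); first by rewrite lt_min !divr_gt0.
move=> t t' tt.
have [tr te] : `|t - t'| < r /\ 2 * `|t - t'| <= e.
  move: tt; rewrite le_min => /andP[h1 h2]; split; last by lra.
  by rewrite (le_lt_trans h1) // ltr_pdivrMr // mulr_natr mulr2n ltrDl.
have -> : expi t - expi t' = expi t' * (expi (t - t') - 1).
  by rewrite mulrBr mulr1 -expiD [t' + _]addrC subrK.
rewrite nmM nm_expi mul1r.
have := hr 0 (t - t'); rewrite normr0 expR0 mul1r add0r mul1r => /(_ r0 tr) h.
rewrite -(subrK (0 +i* (t - t'))%C (expi _ - 1)) (le_trans (nmD _ _)) //.
have : nm (0 +i* (t - t'))%C <= `|t - t'|.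
  by rewrite (le_trans (nm_le_ReIm _)) //= normr0 add0r.
by move: h te; lra.
Qed.

Lemma chi_uniform nu : uniformly_continuous_torus (chi nu : _ -> R[i]).
Proof.
move=> e e0; have [d d0 hd] := expi_uniform e0.
have S0 : 0 <= \sum_j `|(nu 0 j)%:~R| :> R by exact: sumr_ge0.
have [r [r0 _ rd]] := small_factor S0 d0.
exists r => // th th' tt; rewrite !chi_expi; apply: hd.
rewrite -sumrB (le_trans (ler_norm_sum _ _ _)) // (le_trans _ rd) // mulr_sumr.
by apply: ler_sum => j _; rewrite -mulrBl normrM ler_wpM2r.
Qed.

Lemma uniformM (phi psi : ('I_n -> R) -> R[i]) (M : R) :
  (forall th, nm (phi th) <= M) -> (forall th, nm (psi th) <= M) ->
  uniformly_continuous_torus phi -> uniformly_continuous_torus psi ->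
  uniformly_continuous_torus (fun th => phi th * psi th).
Proof.
move=> phiM psiM uphi upsi e e0.
have M0 : 0 <= M by rewrite (le_trans (nm_ge0 (phi (fun=> 0)))).
have e20 : 0 < e / 2 by rewrite divr_gt0.
have [u [u0 _ ue]] := small_factor M0 e20.
have [d1 d10 h1] := uphi _ u0; have [d2 d20 h2] := upsi _ u0.
exists (Num.min d1 d2); first by rewrite lt_min d10.
move=> th th' tt.
have -> : phi th * psi th - phi th' * psi th' =
  (phi th - phi th') * psi th + phi th' * (psi th - psi th') by ring.
rewrite (le_trans (nmD _ _)) // [leRHS]splitr !nmM lerD // (le_trans _ ue) //.
  rewrite ler_pM ?nm_ge0 // h1 // => j.
  by rewrite (le_trans (tt j)) // ge_min lexx.
rewrite mulrC ler_pM ?nm_ge0 // h2 // => j.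
by rewrite (le_trans (tt j)) // ge_min lexx orbT.
Qed.

Lemma uniformZ c (phi : ('I_n -> R) -> R[i]) : uniformly_continuous_torus phi ->
  uniformly_continuous_torus (fun th => c * phi th).
Proof.
move=> uphi e e0; have [u [u0 _ ue]] := small_factor (nm_ge0 c) e0.
have [d d0 h] := uphi _ u0; exists d => // th th' tt.
by rewrite -mulrBr nmM (le_trans _ ue) // mulrC ler_wpM2r ?nm_ge0 // h.
Qed.

(** The value is 0 by default when the averages have no limit. *)
Definition mean (phi : ('I_n -> R) -> R[i]) : R[i] :=
  locked (xget 0 [set L | ctends (fun N => avg N.+1 phi) L]).

Lemma meanP phi : uniformly_continuous_torus phi ->
  ctends (fun N => avg N.+1 phi) (mean phi).
Proof. by move=> /avg_limit[L hL]; rewrite /mean -lock; case: xgetP => [M -> //|/(_ L)]. Qed.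

Definition fourier (g : V -> R[i]) z nu : R[i] :=
  mean (fun th => g (rot th z) * chi (- nu) th).

End TorusFourier.

(** * Uniform continuity on compact sets and tori *)

Section ReinhardtFourier.
Variables (R : realType) (n : nat).
Local Notation V := 'rV[R[i]^o]_n.
Variables (U : set V) (g : V -> R[i]^o).
Implicit Types (z : V) (nu : 'rV[int]_n) (th : 'I_n -> R).
Hypothesis rotU : forall z, U z -> forall th, U (rot th z).
Hypothesis dg : forall z, U z -> differentiable g z.

(** The two points differ by a rotation in each coordinate, even where both vanish, since [polar]
    gives 0 an argument too. So arguments may be chosen freely. *)
Lemma reinhardt_moduli z z' : U z -> (forall j, nm (z' 0 j) = nm (z 0 j)) -> U z'.
Proof.
move=> Uz h; have /choice[th hth] : forall j, exists t, z' 0 j = expi t * z 0 j.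
  move=> j; have [t tE] := polar (z 0 j); have [t' t'E] := polar (z' 0 j).
  exists (t' - t); move: tE t'E; rewrite h.
  move: ((nm (z 0 j))%:C)%C => r -> ->.
  by rewrite expiD expiN mulrCA divfK ?expi_neq0.
suff -> : z' = rot th z by exact: rotU.
by apply/rowP => j; rewrite mxE.
Qed.

(** Only [z] is confined to [K]: [z'] may leave it, which is needed to compare a torus with a
    neighbouring one. *)
Lemma compact_uniform_continuity (K : set V) (e : R) : compact K -> K `<=` U -> 0 < e ->
  exists2 d : R, 0 < d & forall z z', K z -> close d z z' -> nm (g z' - g z) <= e.
Proof.
move=> cK KU e0.
have [m hm] : exists m, forall z, K z -> forall z', close (m.+1%:R^-1) z z' ->
    nm (g z' - g z) <= e.
  apply: (compact_uniform cK) => z Kz; have e20 : 0 < e / 2 by rewrite divr_gt0.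
  have [d d0 hd] := differentiable_close (dg (KU _ Kz)) e20.
  exists (d / 2); first by rewrite divr_gt0.
  have d20 : 0 <= 2 / d by rewrite divr_ge0 // ltW.
  exists (Num.bound (2 / d)) => z1 i zz1 hi z2 z12.
  have hi' : i.+1%:R^-1 <= d / 2.
    rewrite -[leRHS]invrK invf_div lef_pV2 ?posrE ?ltr0n ?divr_gt0 //.
    rewrite (le_trans (ltW (archi_boundP d20))) // ler_nat.
    exact: leqW.
  rewrite (le_trans (nm_dist (g z) _ _)) // [leRHS]splitr lerD //.
    rewrite ltW // hd // => j; rewrite (le_lt_trans (nm_dist (z1 0 j) _ _)) //.
    by rewrite [ltRHS]splitr ltrD // (lt_le_trans (z12 j)).
  rewrite nmB ltW // hd // => j; rewrite (lt_trans (zz1 j)) //.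
  by rewrite ltr_pdivrMr // mulr_natr mulr2n ltrDl.
exists (m.+1%:R^-1); first by rewrite invr_gt0 ltr0n.
by move=> z z' Kz; exact: hm.
Qed.

Lemma compact_bounded (K : set V) : compact K -> K `<=` U ->
  exists2 M : R, 0 <= M & forall z, K z -> nm (g z) <= M.
Proof.
move=> cK KU; have [m hm] : exists m, forall z, K z -> nm (g z) <= m%:R.
  apply: (compact_uniform cK) => z Kz.
  have [d d0 hd] := differentiable_close (dg (KU _ Kz)) ltr01.
  exists d => //.
  have p0 : 0 <= 1 + nm (g z) by rewrite addr_ge0 ?nm_ge0.
  exists (Num.bound (1 + nm (g z))) => z' i zz' hi.
  rewrite -[g z'](subrK (g z)) (le_trans (nmD _ _)) //.
  rewrite (le_trans (lerD (ltW (hd _ zz')) (lexx _))) //.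
  by rewrite (le_trans (ltW (archi_boundP p0))) // ler_nat.
by exists m%:R.
Qed.

Definition torus z : set V := [set z' | forall j, nm (z' 0 j) = nm (z 0 j)].

Lemma compact_torus z : compact (torus z).
Proof.
rewrite (_ : torus z = [set z' : V | forall j, nm (z 0 j) <= nm (z' 0 j) <= nm (z 0 j)]).
  exact: (@compact_polyannulus R n (fun j => nm (z 0 j)) (fun j => nm (z 0 j))).
apply/seteqP; split => z' h j; last by apply/eqP; rewrite eq_le andbC h.
by rewrite h lexx.
Qed.

Lemma torus_sub z : U z -> torus z `<=` U.
Proof. by move=> Uz z' h; exact: reinhardt_moduli h. Qed.

Lemma torus_rot z th : torus z (rot th z).
Proof. by move=> j; rewrite mxE nmM nm_expi mul1r. Qed.

Lemma torus_function_uniform z : U z ->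
  uniformly_continuous_torus (fun th => g (rot th z)).
Proof.
move=> Uz e e0.
have [d d0 hd] := compact_uniform_continuity (compact_torus (z:=z)) (torus_sub Uz) e0.
have S0 : 0 <= \sum_j nm (z 0 j) by apply: sumr_ge0 => j _; exact: nm_ge0.
have d20 : 0 < d / 2 by rewrite divr_gt0.
have [u [u0 _ ud]] := small_factor S0 d20; have [r r0 hr] := expi_uniform u0.
exists r => // th th' tt; apply: hd; first exact: torus_rot.
move=> j; rewrite !mxE -mulrBl nmM (@le_lt_trans _ _ (d / 2)) //; last first.
  by rewrite ltr_pdivrMr // mulr_natr mulr2n ltrDl.
rewrite (le_trans _ ud) // ler_pM ?nm_ge0 ?hr //.
by rewrite (bigD1 j) //= lerDl sumr_ge0 // => i _; exact: nm_ge0.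
Qed.

Lemma torus_character_uniform z nu : U z ->
  uniformly_continuous_torus (fun th => g (rot th z) * chi (- nu) th).
Proof.
move=> Uz; have [M M0 hM] := compact_bounded (compact_torus (z:=z)) (torus_sub Uz).
apply: (@uniformM _ _ _ _ (M + 1)).
- by move=> th; rewrite (le_trans (hM _ (torus_rot _ _))) // lerDl.
- by move=> th; rewrite nm_chi lerDr.
- exact: torus_function_uniform.
- exact: chi_uniform.
Qed.

Lemma fourier_limit z nu : U z ->
  ctends (fun N => avg N.+1 (fun th => g (rot th z) * chi (- nu) th)) (fourier g z nu).
Proof. by move=> Uz; apply: meanP; exact: torus_character_uniform. Qed.

End ReinhardtFourier.

(** * Moving a single coordinate *)

Section FourierMonomial.
Variables (R : realType) (n : nat).
Local Notation V := 'rV[R[i]^o]_n.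
Variables (U : set V) (g : V -> R[i]^o).
Implicit Types (z p : V) (nu : 'rV[int]_n) (th : 'I_n -> R).
Hypothesis rotU : forall z, U z -> forall th, U (rot th z).
Hypothesis dg : forall z, U z -> differentiable g z.

Lemma upd_same th (j : 'I_n) (t : R) : upd th j t j = t.
Proof. by rewrite /upd eqxx. Qed.

Lemma upd_other th (j i : 'I_n) (t : R) : i != j -> upd th j t i = th i.
Proof. by rewrite /upd => /negbTE ->. Qed.

Lemma chi_upd nu th (j : 'I_n) (t : R) :
  chi nu (upd th j t) = expi t ^ (nu 0 j) * \prod_(i | i != j) expi (th i) ^ (nu 0 i).
Proof.
rewrite /chi [LHS](bigD1 j isT).
rewrite [X in X * _]/= upd_same.
apply: congr1.
by apply: eq_bigr => i ij; rewrite upd_other.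
Qed.

Lemma rot_upd z th j t : rot (upd th j t) z = setc (rot th z) j (z 0 j * expi t).
Proof.
by apply/rowP => i; rewrite !mxE /upd; case: eqP => // ->; rewrite mulrC.
Qed.

Lemma rot_setc z th j (w : R[i]) t :
  rot (upd th j t) (setc z j w) = setc (rot th z) j (w * expi t).
Proof.
by apply/rowP => i; rewrite !mxE /upd; case: eqP => // _; rewrite mulrC.
Qed.

(** As a function of the j-th coordinate w, g times w^(-nu_j) is complex differentiable along the
    path, so [avg1_goursat] compares its averages over two circles; [avg_coord] spreads the
    comparison over the other angles. Hypothesis on the path: only real factors, because rotations
    come for free in [U]. *)
Lemma fourier_slice z j (lam : R[i]) nu : U z -> lam != 0 -> z 0 j != 0 ->
  (forall s, 0 <= s <= 1 -> U (setc z j (z 0 j * (expR (s * ln (nm lam)))%:C%C))) ->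
  fourier g (setc z j (z 0 j * lam)) nu = lam ^ (nu 0 j) * fourier g z nu.
Proof.
move=> Uz lam0 zj0 path; set z' := setc _ _ _; set k := nu 0 j.
have nlam : 0 < nm lam by rewrite nm_gt0.
set tau := ln (nm lam) in path; have [alpha lamE] := polar lam.
have tauE : expR tau = nm lam by rewrite lnK.
have Uz' : U z'.
  apply: (reinhardt_moduli rotU (path 1 _)); first by rewrite lexx ler01.
  move=> i; rewrite !mxE; case: eqP => // _.
  by rewrite mul1r tauE !nmM nm_real ger0_norm // nm_ge0.
have lamk0 : lam ^ k != 0 by rewrite expfz_neq0.
have [phi phiE] : exists phi, phi = fun th => g (rot th z) * chi (- nu) th by eexists.
have [psi psiE] : exists psi,
    psi = fun th => lam ^ (- k) * (g (rot th z') * chi (- nu) th) by eexists.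
have uphi : uniformly_continuous_torus phi.
  by rewrite phiE; exact: (torus_character_uniform rotU dg).
have upsi : uniformly_continuous_torus psi.
  by rewrite psiE; apply: uniformZ; exact: (torus_character_uniform rotU dg).
suff -> : fourier g z nu = lam ^ (- k) * fourier g z' nu.
  by rewrite mulrA -expfzDr // subrr expr0z mul1r.
have lim1 : ctends (fun N => avg N.+1 phi) (fourier g z nu).
  by rewrite phiE; exact: (fourier_limit rotU dg).
have lim2 : ctends (fun N => avg N.+1 psi) (lam ^ (- k) * fourier g z' nu).
  have := ctendsZ (lam ^ (- k)) (fourier_limit rotU dg nu Uz').
  by apply: ctends_near; exists 0%N => N _; rewrite psiE avgZ.
apply/eqP; rewrite -subr_eq0 -nm_eq0 eq_le nm_ge0 andbT.
apply/ler_addgt0Pr => e e0; rewrite add0r nmB.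
(* [avg1_goursat] loses a factor 4. *)
have e40 : 0 < e / 4 by rewrite divr_gt0.
apply: ctends_nm_le (ctendsB lim2 lim1).
have [d1 d10 h1] := uphi _ e40; have [d2 d20 h2] := upsi _ e40.
have d12 : 0 < Num.min d1 d2 by rewrite lt_min d10.
have [N0 hN0] := angle_small d12.
exists N0 => N /hN0; rewrite le_min => /andP[Nd1 Nd2].
rewrite (avg_coord psi j) // (avg_coord phi j) // -avgB.
apply: nm_avg_le => // kk; set th := grid R kk.
(* The factor [z 0 j ^ k] turns (z_j e^(it))^(-k) into e^(-ikt), so that one function [G] gives the
   integrand [phi] on the circle of z_j and [psi] on that of z_j lam. *)
pose Cj : R[i] := z 0 j ^ k * \prod_(i | i != j) expi (th i) ^ ((- nu) 0 i).
have [G GE] : exists G : R[i] -> R[i],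
    G = fun w => g (setc (rot th z) j w) * (w ^ (- k)) * Cj by eexists.
have nuj : (- nu) 0 j = - k by rewrite mxE.
have zk : z 0 j ^ (- k) * z 0 j ^ k = 1 by rewrite -expfzDr // addrC subrr expr0z.
have aux (a b c d e' f : R[i]) : b * f = 1 -> a * (b * c * d) * (f * e') = c * (a * (d * e')).
  move=> bf; have -> : a * (b * c * d) * (f * e') = (b * f) * (c * (a * (d * e'))) by ring.
  by rewrite bf mul1r.
have Gphi t : G (z 0 j * expi t) = phi (upd th j t).
  rewrite GE phiE -rot_upd chi_upd nuj /Cj (expfzMl (z 0 j : R[i])).
  by rewrite -[z 0 j ^ (- k)]mulr1 (aux _ _ _ _ _ _ zk) mul1r.
have Gpsi t : G (z 0 j * lam * expi t) = psi (upd th j t).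
  rewrite GE psiE rot_setc chi_upd nuj /Cj !(expfzMl (_ : R[i])).
  exact: aux zk.
have Ephi : avg1 N.+1 (fun t => phi (upd th j t)) = avg1 N.+1 (fun t => G (z 0 j * expi t)).
  by apply: congr1; apply/funext => t; exact: esym (Gphi t).
have Epsi : avg1 N.+1 (fun t => psi (upd th j t)) = avg1 N.+1 (fun t => G (z 0 j * lam * expi t)).
  by apply: congr1; apply/funext => t; exact: esym (Gpsi t).
have -> : e = 4 * (e / 4) by rewrite mulrC divfK.
have lamE' : lam = (expR tau)%:C%C * expi alpha by rewrite tauE.
rewrite Ephi Epsi lamE'; apply: avg1_goursat => //.
- move=> s t s01; rewrite GE; apply: derivable_cdiff.
  apply: (@derivableM _ _
    (fun w : R[i]^o => g (setc (rot th z) j w) * (w : R[i]) ^ (- k))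
    (fun=> Cj : R[i]^o)); last exact: derivable_cst.
  apply: (@derivableM _ _ (fun w : R[i]^o => g (setc (rot th z) j w))
    (fun w : R[i]^o => (w : R[i]) ^ (- k) : R[i]^o)).
    apply: derivable_slice; apply: dg.
    apply: (reinhardt_moduli rotU (path s s01)) => i; rewrite !mxE.
    case: eqP => _; last by rewrite nmM nm_expi mul1r.
    by rewrite !nmM nm_expi mulr1.
  apply: derivable_exprz; rewrite !mulf_neq0 ?expi_neq0 //.
  by rewrite -nm_eq0 nm_real normr_eq0 gt_eqF ?expR_gt0.
- move=> t t' tt; rewrite !Gphi; apply: h1 => i; rewrite /upd; case: eqP => _.
    exact: le_trans tt Nd1.
  by rewrite subrr normr0 ltW.
- move=> t t' tt; rewrite -lamE' !Gpsi; apply: h2 => i; rewrite /upd; case: eqP => _.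
    exact: le_trans tt Nd2.
  by rewrite subrr normr0 ltW.
Qed.

End FourierMonomial.

Lemma proportional_trans (K : comPzRingType) (f f' f0 m m' m0 : K) :
  f' * m = f * m' -> f * m0 = f0 * m -> f' * m0 * m = f0 * m' * m.
Proof. by move=> h1 h2; rewrite mulrAC h1 mulrAC h2 mulrAC. Qed.

(** The geometric path from [a] to [b] is monotone in [s], so it stays in every interval that
    contains both ends. *)
Lemma log_path_between (R : realType) (a b p eps s : R) : 0 < a -> 0 < b ->
  `|a - p| <= eps -> `|b - p| <= eps -> 0 <= s <= 1 ->
  `|a * expR (s * ln (b / a)) - p| <= eps.
Proof.
move=> a0 b0 ap bp /andP[s0 s1].
have bE : b = a * expR (ln (b / a)).
  by rewrite lnK ?posrE ?divr_gt0 // mulrC divfK // gt_eqF.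
move: (ln (b / a)) bE => tau bE.
suff [] : Num.min a b <= a * expR (s * tau) /\ a * expR (s * tau) <= Num.max a b.
  by rewrite ge_min le_max => /orP[] ? /orP[] ?; rewrite !ler_norml in ap bp *; lra.
have [t0|/ltW t0] := leP 0 tau.
  split; first by rewrite ge_min ler_peMr ?(ltW a0) // -expR0 ler_expR mulr_ge0.
  by rewrite le_max bE ler_pM2l // ler_expR ler_piMl ?orbT.
split; last by rewrite le_max ler_piMr ?(ltW a0) // -expR0 ler_expR mulr_ge0_le0.
by rewrite ge_min bE ler_pM2l // ler_expR ler_niMl ?orbT.
Qed.

(** * From local to global proportionality *)

Section FourierGlobal.
Variables (R : realType) (n : nat).
Local Notation V := 'rV[R[i]^o]_n.
Variables (U : set V) (g : V -> R[i]^o).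
Implicit Types (z p : V) (nu : 'rV[int]_n) (th : 'I_n -> R).
Hypothesis oU : open U.
Hypothesis rotU : forall z, U z -> forall th, U (rot th z).
Hypothesis dg : forall z, U z -> differentiable g z.

Definition nonzero z := forall j, z 0 j != 0.

(** A closed polyannulus around the torus of [p]; its factor is a disc in each coordinate with |p_j|
    <= eps, so [p] may have zero coordinates. *)
Definition box p (eps : R) : set V :=
  [set z | forall j, `|nm (z 0 j) - nm (p 0 j)| <= eps].

Lemma monom_setc z j (lam : R[i]) nu :
  monom (setc z j (z 0 j * lam)) nu = lam ^ (nu 0 j) * monom z nu.
Proof.
pose F i : R[i] := (z 0 i : R[i]) ^ nu 0 i; pose c i : R[i] := if i == j then lam ^ nu 0 j else 1.
have E i : (setc z j (z 0 j * lam) 0 i : R[i]) ^ nu 0 i = c i * F i.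
  rewrite mxE /c /F; case: eqP => [->|_]; last by rewrite mul1r.
  by rewrite (expfzMl (z 0 j : R[i])) mulrC.
have -> : monom (setc z j (z 0 j * lam)) nu = \prod_i (c i * F i).
  by apply: eq_bigr => i _; exact: E.
by rewrite big_split /= /c -big_mkcond big_pred1_eq.
Qed.

Lemma monom_neq0 z nu : nonzero z -> monom z nu != 0.
Proof. by move=> z0; apply/prodf_neq0 => j _; rewrite expfz_neq0 // z0. Qed.

Lemma close_box p (eps : R) z : close eps p z -> box p eps z.
Proof. by move=> h j; rewrite (le_trans (ler_dist_nm _ _)) // ltW. Qed.

Lemma box_sub p : U p -> exists2 eps : R, 0 < eps & box p eps `<=` U.
Proof.
move=> Up; have [d d0 hd] := open_close oU Up.
exists (d / 2); first by rewrite divr_gt0.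
move=> z hz; have /choice[u hu] : forall j, exists u : R[i],
    nm u = 1 /\ p 0 j = ((nm (p 0 j))%:C)%C * u.
  by move=> j; have [t tE] := polar (p 0 j); exists (expi t); rewrite nm_expi.
(* [y] has the moduli of [z] and the arguments of [p], so |y_j - p_j| is just the difference of the
   moduli. *)
pose y : V := \row_j (((nm (z 0 j))%:C)%C * u j).
apply: (@reinhardt_moduli R n U rotU y).
  apply: hd => j; have [u1 uE] := hu j.
  rewrite mxE [X in _ - X]uE -mulrBl -rmorphB nmM u1 mulr1 nm_real.
  by rewrite (le_lt_trans (hz j)) // ltr_pdivrMr // mulr_natr mulr2n ltrDl.
move=> j; have [u1 _] := hu j.
by rewrite mxE nmM u1 mulr1 nm_real ger0_norm // nm_ge0.
Qed.

Lemma fourier_box p (eps : R) nu z z' : box p eps `<=` U ->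
  box p eps z -> box p eps z' -> nonzero z -> nonzero z' ->
  fourier g z' nu * monom z nu = fourier g z nu * monom z' nu.
Proof.
move=> bU bz bz' nz nz'.
(* The coordinates of [z] are replaced by those of [z'] one at a time; the box is a product, so
   every intermediate point lies in it. *)
pose hyb (k : nat) : V := \row_j if (j < k)%N then z' 0 j else z 0 j.
have bh k : box p eps (hyb k) by move=> j; rewrite mxE; case: ifP.
suff H k : (k <= n)%N -> fourier g (hyb k) nu * monom z nu = fourier g z nu * monom (hyb k) nu.
  have := H n (leqnn n); rewrite (_ : hyb n = z') //.
  by apply/rowP => j; rewrite mxE ltn_ord.
elim: k => [_|k ih kn].
  by rewrite (_ : hyb 0%N = z) //; apply/rowP => j; rewrite mxE ltn0.
have {}ih := ih (ltnW kn); pose j := Ordinal kn; pose lam : R[i] := z' 0 j / z 0 j.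
have hj : hyb k 0 j = z 0 j by rewrite mxE ltnn.
have hS : hyb k.+1 = setc (hyb k) j (hyb k 0 j * lam).
  apply/rowP => i; rewrite hj !mxE ltnS leq_eqVlt.
  have [->|ij] := eqVneq i j; first by rewrite eqxx /= /lam mulrC divfK // nz.
  have -> : (nat_of_ord i == k) = false by exact: (negbTE ij).
  by [].
have nzj : 0 < nm (z 0 j) by rewrite nm_gt0.
have nzj' : 0 < nm (z' 0 j) by rewrite nm_gt0.
have lam0 : lam != 0 by rewrite mulf_neq0 ?invr_eq0 ?nz ?nz'.
have nlam : nm lam = nm (z' 0 j) / nm (z 0 j) by rewrite nmM nmV.
have path s : 0 <= s <= 1 ->
    U (setc (hyb k) j (hyb k 0 j * (expR (s * ln (nm lam)))%:C%C)).
  move=> s01; apply: bU => i; rewrite hj mxE.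
  case: eqP => [->|_]; last exact: bh.
  rewrite nmM nm_real (gtr0_norm (expR_gt0 _)) nlam.
  exact: log_path_between (bz j) (bz' j) s01.
have hj0 : hyb k 0 j != 0 by rewrite hj nz.
have slice := fourier_slice rotU dg nu (bU _ (bh k)) lam0 hj0 path.
by rewrite hS slice monom_setc -mulrA ih mulrCA.
Qed.

Lemma near_nonzero p (d : R) : 0 < d -> exists2 z, close d p z & nonzero z.
Proof.
move=> d0; have d20 : 0 < d / 2 by rewrite divr_gt0.
exists (\row_j if p 0 j == 0 then ((d / 2)%:C)%C else p 0 j).
  move=> j; rewrite mxE; case: eqP => [->|_]; last by rewrite subrr nm0.
  by rewrite subr0 nm_real gtr0_norm // ltr_pdivrMr // mulr_natr mulr2n ltrDl.
move=> j; rewrite mxE; have [p0|//] := eqVneq (p 0 j) 0.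
by rewrite -nm_eq0 nm_real normr_eq0 gt_eqF.
Qed.

Hypothesis cU : connected U.

(* The identity holds near z0 by [fourier_box]; the set of points of U near which it
   holds is open and closed in U. *)
Lemma fourier_nonzero z0 z nu : U z0 -> nonzero z0 -> U z -> nonzero z ->
  fourier g z nu * monom z0 nu = fourier g z0 nu * monom z nu.
Proof.
move=> Uz0 nz0 Uz nz.
have [P PE] : exists P : V -> Prop, forall y,
    P y <-> fourier g y nu * monom z0 nu = fourier g z0 nu * monom y nu.
  by eexists => y; exact: iff_refl.
apply/PE.
(* A point of [C] may have zero coordinates; only the nonzero points near it are tested. In this way
   the connectedness of [U] is used directly, rather than that of its nonzero points. *)
pose C : set V := [set p | exists2 d : R, 0 < d &
  forall y, U y -> close d p y -> nonzero y -> P y].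
have boxP p eps y : box p eps `<=` U -> 0 < eps -> box p eps y -> nonzero y -> P y -> C p.
  move=> bU e0 yb ny /PE Py; exists eps; first exact: e0.
  move=> y' Uy' /close_box y'b ny'.
  have h := fourier_box nu bU yb y'b ny ny'; apply/PE.
  apply: (mulIf (monom_neq0 nu ny)).
  exact: proportional_trans h Py.
have oC : open C.
  apply: close_open => p [d d0 hd]; exists (d / 2); first by rewrite divr_gt0.
  move=> p' pp'; exists (d / 2); first by rewrite divr_gt0.
  move=> y Uy py ny; apply: hd => // j.
  by rewrite (le_lt_trans (nm_dist (p' 0 j) _ _)) // [ltRHS]splitr ltrD.
pose D : set V := [set p | U p /\ ~ C p].
have oD : open D.
  apply: close_open => p [Up nCp]; have [eps e0 bU] := box_sub Up.
  exists (eps / 2); first by rewrite divr_gt0.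
  move=> p' pp'; split.
    apply/bU/close_box => j; rewrite (lt_trans (pp' j)) //.
    by rewrite ltr_pdivrMr // mulr_natr mulr2n ltrDl.
  move=> [d d0 hd]; apply: nCp.
  have m0 : 0 < Num.min d (eps / 2) by rewrite lt_min d0 divr_gt0.
  (* [y] is so near [p'] that the identity holds at it, and it lies in the box of [p]; then [boxP]
     puts [p] in [C], a contradiction. *)
  have [y yp' ny] := near_nonzero p' m0.
  have yb : box p eps y.
    apply: close_box => j; rewrite (le_lt_trans (nm_dist (p' 0 j) _ _)) //.
    rewrite [ltRHS]splitr ltrD // (lt_le_trans (yp' j)) //.
    by rewrite ge_min lexx orbT.
  apply: (boxP p eps y) => //; apply: hd => //; first exact: bU.
  by move=> j; rewrite (lt_le_trans (yp' j)) // ge_min lexx.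
have UC : U `&` C = U.
  apply: cU.
  - exists z0; split=> //; have [eps e0 bU] := box_sub Uz0.
    apply: (boxP z0 eps z0) => //; last by apply/PE.
    by move=> j; rewrite subrr normr0 ltW.
  - by exists C.
  - exists (~` D); first exact: open_closedC.
    apply/seteqP; split => p [Up]; first by move=> Cp; split=> // -[].
    by move=> nD; split=> //; apply: contrapT => nC; apply: nD.
have [_ [d d0 hd]] : (U `&` C) z by rewrite UC.
by apply: hd => // j; rewrite subrr nm0.
Qed.

(** Where z_j = 0 the value of g does not depend on th_j, so averaging over this angle leaves the
    mean of a nontrivial character, which is 0 on fine grids. *)
Lemma fourier_vanish z j nu : U z -> z 0 j = 0 -> nu 0 j != 0 -> fourier g z nu = 0.
Proof.
move=> Uz zj nj; apply: (ctends_unique (fourier_limit rotU dg nu Uz)).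
apply: ctends_near (ctends_cst 0); exists `|(nu 0 j)%R|%N => N hN.
rewrite (avg_coord _ j) //.
rewrite (@eq_avg R n N.+1 _ (fun=> 0 * 0)); first by rewrite avgZ mul0r.
move=> th; rewrite mul0r /avg1.
rewrite (eq_bigr (fun l : 'I_N.+1 => (g (rot th z) * \prod_(i | i != j) expi (th i) ^ ((- nu) 0 i))
   * expi (angle R N.+1 l) ^ (- nu 0 j))).
  rewrite -mulr_sumr mulrCA.
  have := @avg1_expi_eq0 R N.+1 (- nu 0 j); rewrite /avg1 => -> //; first by rewrite mulr0.
  by rewrite abszN lt0n absz_eq0 nj.
move=> l _; rewrite chi_upd mxE -mulrA [X in _ * X]mulrC; congr (g _ * _).
by apply/rowP => i; rewrite !mxE /upd; case: eqP => // ->; rewrite zj !mulr0.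
Qed.

Lemma fourier_monomial z0 z nu : U z0 -> nonzero z0 -> U z ->
  fourier g z nu * monom z0 nu = fourier g z0 nu * monom z nu.
Proof.
move=> Uz0 nz0 Uz.
have [[j [zj nj]]|noz] := pselect (exists j, z 0 j = 0 /\ nu 0 j != 0).
  (* True for negative exponents too, by the convention 0^-1 = 0; both sides of the identity
     vanish. *)
  have z0k : z 0 j ^ nu 0 j = 0 by rewrite zj exp0rz (negbTE nj).
  have mz : monom z nu = 0 by apply/eqP/prodf_eq0; exists j; rewrite ?z0k.
  by rewrite (fourier_vanish Uz zj nj) mz mul0r mulr0.
have zn j : z 0 j = 0 -> nu 0 j = 0.
  by move=> zj; apply/eqP; apply: contra_notT noz => nj; exists j.
apply/eqP; rewrite -subr_eq0 -nm_eq0 eq_le nm_ge0 andbT.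
apply/ler_addgt0Pr => e e0; rewrite add0r.
have [u [u0 _ ue]] := small_factor (nm_ge0 (monom z0 nu)) e0.
have [d1 d10 h1] := compact_uniform_continuity dg (compact_torus (z:=z)) (torus_sub rotU Uz) u0.
have [d2 d20 h2] := open_close oU Uz.
have d0 : 0 < Num.min d1 d2 by rewrite lt_min d10.
pose d := Num.min d1 d2.
(* Now nu_j = 0 wherever z_j = 0, so filling these coordinates with [d / 2] leaves the monomial
   unchanged and moves the coefficient by at most [u]. *)
pose y : V := \row_j if z 0 j == 0 then ((d / 2)%:C)%C else z 0 j.
have dd2 : 0 < d / 2 by rewrite divr_gt0.
have yc : close d z y.
  move=> j; rewrite mxE; case: eqP => [->|_]; last by rewrite subrr nm0.
  by rewrite subr0 nm_real gtr0_norm // ltr_pdivrMr // mulr_natr mulr2n ltrDl.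
have ny : nonzero y.
  move=> j; rewrite mxE; have [p0|//] := eqVneq (z 0 j) 0.
  by rewrite -nm_eq0 nm_real normr_eq0 gt_eqF.
have Uy : U y by apply: h2 => j; rewrite (lt_le_trans (yc j)) // ge_min lexx orbT.
have my : monom y nu = monom z nu.
  apply: eq_bigr => j _; rewrite mxE; case: eqP => [zj|_]; last by [].
  by rewrite (zn j zj) !expr0z.
have Fyz : nm (fourier g z nu - fourier g y nu) <= u.
  apply: ctends_nm_le (ctendsB (fourier_limit rotU dg nu Uz) (fourier_limit rotU dg nu Uy)).
  exists 0%N => N _; rewrite -avgB; apply: nm_avg_le => // k.
  rewrite -mulrBl nmM nm_chi mulr1 nmB; apply: h1; first exact: torus_rot.
  move=> j; rewrite !mxE -mulrBr nmM nm_expi mul1r.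
  by have := yc j; rewrite mxE => /lt_le_trans; apply; rewrite ge_min lexx.
rewrite -my -(fourier_nonzero nu Uz0 nz0 Uy ny) -mulrBl nmM (le_trans _ ue) //.
by rewrite ler_wpM2r // nm_ge0.
Qed.

End FourierGlobal.

(** * Summation and Cauchy estimates *)

Section GeometricSums.
Variables (R : realType) (n : nat).
Implicit Types (q r : R) (nu : 'rV[int]_n).

Definition gweight q nu : R := \prod_j q ^+ `|(nu 0 j)%R|%N.

Lemma gweight_ge0 q nu : 0 <= q -> 0 <= gweight q nu.
Proof. by move=> q0; apply: prodr_ge0 => j _; rewrite exprn_ge0. Qed.

Lemma gweightM q r nu : gweight (q * r) nu = gweight q nu * gweight r nu.
Proof. by rewrite /gweight -big_split; apply: eq_bigr => j _; rewrite exprMn. Qed.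

Lemma le_gweight q r nu : 0 <= q -> q <= r -> gweight q nu <= gweight r nu.
Proof.
move=> q0 qr; apply: ler_prod => j _; rewrite exprn_ge0 //=.
by rewrite lerXn2r // nnegrE // (le_trans q0).
Qed.

Lemma geometric_le r m : 0 <= r -> r < 1 -> \sum_(a < m) r ^+ a <= (1 - r)^-1.
Proof.
move=> r0 r1; have d0 : 0 < 1 - r by rewrite subr_gt0.
rewrite -[leRHS]mul1r ler_pdivlMr // mulrC.
have -> : (1 - r) * \sum_(a < m) r ^+ a = 1 - r ^+ m.
  by apply/eqP; rewrite -opprB mulNr -subrX1 opprB.
by rewrite gerBl exprn_ge0.
Qed.

(* An integer is recorded by its absolute value and its sign, so that the sum over
   a bounded box of Z^n is dominated by a power of a geometric sum. *)
Lemma gweight_sum r (s : seq 'rV[int]_n) : 0 <= r -> r < 1 -> uniq s ->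
  \sum_(nu <- s) gweight r nu <= (2 * (1 - r)^-1) ^+ n.
Proof.
move=> r0 r1 us.
pose m := \max_(nu <- s) \max_j `|(nu 0 j)%R|%N.
have sm nu j : nu \in s -> (`|(nu 0 j)%R| <= m)%N.
  move=> nus; apply: (@leq_trans (\max_j `|(nu 0 j)%R|%N)).
    exact: (leq_bigmax (F := fun j => `|(nu 0 j)%R|%N)).
  exact: (@leq_bigmax_seq _ s xpredT (fun nu : 'rV[int]_n => \max_j `|(nu 0 j)%R|%N)).
pose dec nu : {ffun 'I_n -> 'I_m.+1 * bool} :=
  [ffun j => (inord `|(nu 0 j)%R|%N, nu 0 j < 0)].
pose w (k : {ffun 'I_n -> 'I_m.+1 * bool}) : R := \prod_j r ^+ (k j).1.
have wdec nu : nu \in s -> gweight r nu = w (dec nu).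
  by move=> nus; apply: eq_bigr => j _; rewrite ffunE /= inordK // ltnS sm.
have udec : uniq (map dec s).
  rewrite map_inj_in_uniq // => mu nu ms ns /ffunP e; apply/rowP => j.
  have := e j; rewrite !ffunE => -[] /(congr1 val) /=.
  rewrite !inordK ?ltnS ?sm // => ab ltE.
  by have := intEsign (mu 0 j); rewrite ab ltE -intEsign.
have -> : \sum_(nu <- s) gweight r nu = \sum_(k <- map dec s) w k.
  by rewrite big_map big_seq [RHS]big_seq; apply: eq_bigr => nu; exact: wdec.
rewrite big_uniq //=.
have w0 k : 0 <= w k by apply: prodr_ge0 => j _; rewrite exprn_ge0.
apply: (@le_trans _ _ (\sum_k w k)).
  by rewrite big_mkcond; apply: ler_sum => k _; case: ifP.
rewrite /w -(bigA_distr_bigA (fun (_ : 'I_n) (k : 'I_m.+1 * bool) => r ^+ k.1)).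
rewrite prodr_const card_ord; apply: lerXn2r.
- by rewrite nnegrE sumr_ge0 // => k _; rewrite exprn_ge0.
- by rewrite nnegrE mulr_ge0 // invr_ge0 subr_ge0 ltW.
rewrite -(pair_big xpredT xpredT (fun (a : 'I_m.+1) (_ : bool) => r ^+ a)) /=.
under eq_bigr do rewrite big_bool /= -mulr2n -mulr_natl.
by rewrite -mulr_sumr ler_wpM2l // geometric_le.
Qed.

Definition index_box (m : nat) : set 'rV[int]_n :=
  [set nu | forall j, (`|(nu 0%R j)%R| <= m)%N].

Lemma finite_index_box m : finite_set (index_box m).
Proof.
pose enc (k : {ffun 'I_n -> 'I_m.+1 * bool}) : 'rV[int]_n :=
  \row_j ((-1) ^+ (k j).2 * (nat_of_ord (k j).1)%:Z).
apply: (@sub_finite_set _ _ (range enc)).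
  move=> nu h; exists [ffun j => (inord `|(nu 0 j)%R|%N, nu 0 j < 0)] => //.
  apply/rowP => j; rewrite !mxE ffunE /= inordK ?ltnS //.
  by rewrite [RHS]intEsign.
exact: finite_image.
Qed.

(** With q = r^2, one factor r^|nu| is at most r^m outside the box and makes the sum small; the
    other keeps it summable. *)
Lemma gweight_tail q (e : R) : 0 <= q -> q < 1 -> 0 < e ->
  exists m, forall s : seq 'rV[int]_n, uniq s ->
  (forall nu, nu \in s -> ~ index_box m nu) -> \sum_(nu <- s) gweight q nu <= e.
Proof.
move=> q0 q1 e0; pose r := Num.sqrt q.
have r0 : 0 <= r by exact: sqrtr_ge0.
have rr : r * r = q by rewrite -expr2 sqr_sqrtr.
have r1 : r < 1 by rewrite -sqrtr1 ltr_sqrt.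
have S0 : 0 <= (2 * (1 - r)^-1) ^+ n by rewrite exprn_ge0 // mulr_ge0 // invr_ge0 subr_ge0 ltW.
have [u [u0 _ ue]] := small_factor S0 e0.
have [m hm] : exists m, r ^+ m < u.
  have : (fun k => r ^+ k) @ \oo --> (0 : R) by apply: cvg_expr; rewrite ger0_norm.
  move/cvgrPdist_lt => /(_ u u0)[m _ h]; exists m.
  by have := h m (leqnn m); rewrite /= sub0r normrN ger0_norm // exprn_ge0.
exists m => s us hs; rewrite (le_trans _ ue) //.
apply: (@le_trans _ _ (\sum_(nu <- s) u * gweight r nu)); last first.
  by rewrite -mulr_sumr ler_wpM2l ?(ltW u0) // gweight_sum.
rewrite big_seq [leRHS]big_seq; apply: ler_sum => nu /hs nb.
rewrite -rr gweightM ler_wpM2r ?gweight_ge0 // ltW // (le_lt_trans _ hm) //.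
have [j hj] : exists j, (m < `|(nu 0%R j)%R|)%N.
  apply: contrapT => nj; apply: nb => j; rewrite leqNgt; apply/negP => h.
  by apply: nj; exists j.
rewrite /gweight (bigD1 j) //= -[leRHS]mulr1 ler_pM ?exprn_ge0 //.
- by apply: prodr_ge0 => i _; rewrite exprn_ge0.
- by rewrite ler_wiXn2l // ?(ltW r1) // ltnW.
- by apply: prodr_ile1 => i _; rewrite exprn_ge0 //= exprn_ile1 // ltW.
Qed.

End GeometricSums.

(** * Cauchy estimates and normal convergence *)

Section LaurentBounds.
Variables (R : realType) (n : nat).
Local Notation V := 'rV[R[i]^o]_n.
Variables (U : set V) (g : V -> R[i]^o).
Implicit Types (z p : V) (nu : 'rV[int]_n) (th : 'I_n -> R).
Hypothesis oU : open U.
Hypothesis rotU : forall z, U z -> forall th, U (rot th z).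
Hypothesis dg : forall z, U z -> differentiable g z.

Lemma compact_box p (eps : R) : compact (box p eps).
Proof.
rewrite (_ : box p eps =
  [set z : V | forall j, nm (p 0 j) - eps <= nm (z 0 j) <= nm (p 0 j) + eps]).
  exact: (@compact_polyannulus R n (fun j => nm (p 0 j) - eps) (fun j => nm (p 0 j) + eps)).
by apply/seteqP; split => z h j; have := h j; rewrite ler_distl.
Qed.

Lemma fourier_le p (eps M : R) z nu : box p eps `<=` U ->
  (forall y, box p eps y -> nm (g y) <= M) -> box p eps z -> nm (fourier g z nu) <= M.
Proof.
move=> bU hM bz; apply: ctends_nm_le (fourier_limit rotU dg nu (bU _ bz)).
exists 0%N => N _; apply: nm_avg_le => [//|k]; rewrite nmM nm_chi mulr1; apply: hM => j.
by rewrite mxE nmM nm_expi mul1r.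
Qed.

Lemma nm_monom z nu : nm (monom z nu) = \prod_j nm (z 0 j) ^ nu 0 j.
Proof.
have -> : nm (monom z nu) = \prod_j nm ((z 0 j : R[i]) ^ nu 0 j) by exact: nm_prod.
by apply: eq_bigr => j _; rewrite nm_exprz.
Qed.

Variable c : 'rV[int]_n -> R[i].
Hypothesis fourier_c : forall z nu, U z -> fourier g z nu = c nu * monom z nu.

(* Cauchy estimate at the point y whose j-th modulus is scaled up or down
   according to the sign of nu_j. *)
Lemma local_term_bound p : U p -> exists2 d : R, 0 < d & exists M q : R,
  [/\ 0 <= M, 0 <= q, q < 1 & forall z, close d p z ->
      forall nu, nm (c nu * monom z nu) <= M * gweight q nu].
Proof.
move=> Up; have [eps e0 bU] := box_sub oU rotU Up.
have [M M0 hM] := compact_bounded dg (compact_box (p:=p) (eps:=eps)) bU.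
have e20 : 0 < eps / 2 by rewrite divr_gt0.
exists (eps / 2) => //.
(* [B] bounds all moduli near [p], and q = B / (B + eps / 2) is chosen so that multiplying a modulus
   up to [B] by q or 1/q moves it by at most [eps / 2]. *)
pose B := \sum_j nm (p 0 j) + eps.
have B0 : 0 < B by rewrite ltr_wpDl // sumr_ge0 // => j _; exact: nm_ge0.
have Bq0 : 0 < B + eps / 2 by rewrite addr_gt0.
pose q := B / (B + eps / 2).
have q0 : 0 < q by rewrite divr_gt0.
have q1 : q < 1 by rewrite ltr_pdivrMr // mul1r ltrDl.
exists M, q; split=> //; first exact: ltW.
move=> z zp nu.
have zB j : nm (z 0 j) <= B.
  have h1 : nm (z 0 j) <= nm (p 0 j) + eps / 2.
    rewrite -[z 0 j](subrK (p 0 j)) (le_trans (nmD _ _)) // addrC lerD2l.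
    exact: ltW.
  rewrite (le_trans h1) // lerD //; last by rewrite ler_pdivrMr // mulr_natr mulr2n lerDl ltW.
  by rewrite (bigD1 j) //= lerDl sumr_ge0 // => i _; exact: nm_ge0.
clearbody B.
have scale_up a : 0 <= a -> a <= B -> `|a * q^-1 - a| <= eps / 2.
  move=> a0 aB; have -> : a * q^-1 - a = a / B * (eps / 2).
    by rewrite /q invf_div mulrDl mulfV ?gt_eqF // mulrDr mulr1 addrAC subrr add0r; ring.
  rewrite ger0_norm; last by rewrite mulr_ge0 ?divr_ge0 // ltW.
  by rewrite ler_piMl ?(ltW e20) // ler_pdivrMr // mul1r.
have scale_down a : 0 <= a -> a <= B -> `|a * q - a| <= eps / 2.
  move=> a0 aB; have -> : a * q - a = - (a / (B + eps / 2) * (eps / 2)).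
    have -> : q = 1 - (eps / 2) / (B + eps / 2).
      by rewrite /q -{1}[B](addrK (eps / 2)) mulrBl mulfV // gt_eqF.
    by ring.
  rewrite normrN ger0_norm; last by rewrite mulr_ge0 ?divr_ge0 // ltW.
  by rewrite ler_piMl ?(ltW e20) // ler_pdivrMr // mul1r (le_trans aB) // lerDl ltW.
(* Enlarging the modulus for positive exponents and shrinking it for negative ones gains a factor q
   per unit of |k| in both cases. *)
pose sc (k : int) : R := if k == 0 then 1 else if 0 < k then q^-1 else q.
have sc0 k : 0 < sc k by rewrite /sc; do 2![case: ifP => // _]; rewrite invr_gt0.
have scE a (k : int) : a ^ k = (a * sc k) ^ k * q ^+ `|k|%N.
  rewrite expfzMl -mulrA; suff -> : sc k ^ k * q ^+ `|k|%N = 1 by rewrite mulr1.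
  have qq m : q^-1 ^+ m * q ^+ m = 1 by rewrite -exprMn mulVf ?expr1n // gt_eqF.
  rewrite /sc; case: (intP k) => [|m|m]; first by rewrite eqxx expr0z mul1r.
    exact: qq.
  rewrite oppr_eq0 /= ?oppr_gt0 /= ?abszN -invr_expz /=.
  by rewrite mulVf // expf_neq0 // gt_eqF.
pose y : V := \row_j (z 0 j * ((sc (nu 0 j))%:C)%C).
have nmy j : nm (y 0 j) = nm (z 0 j) * sc (nu 0 j).
  by rewrite mxE nmM nm_real gtr0_norm.
have yb : box p eps y.
  move=> j; rewrite nmy.
  have h1 : `|nm (z 0 j) * sc (nu 0 j) - nm (z 0 j)| <= eps / 2.
    rewrite /sc; case: ifP => _; first by rewrite mulr1 subrr normr0 ltW.
    by case: ifP => _; [exact: scale_up (nm_ge0 _) (zB j)|exact: scale_down (nm_ge0 _) (zB j)].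
  have h2 : `|nm (z 0 j) - nm (p 0 j)| <= eps / 2.
    by rewrite (le_trans (ler_dist_nm _ _)) // ltW.
  rewrite -(subrK (nm (z 0 j)) (_ * _)) -addrA [leRHS]splitr.
  by rewrite (le_trans (ler_normD _ _)) // lerD.
have -> : nm (c nu * monom z nu) = nm (fourier g y nu) * gweight q nu.
  have mE : nm (monom z nu) = nm (monom y nu) * gweight q nu.
    rewrite (nm_monom z) (nm_monom y) /gweight -big_split /=.
    by apply: eq_bigr => j _; rewrite nmy; exact: scE.
  apply: (etrans (nmM (c nu) (monom z nu))); rewrite mE mulrA.
  apply: (congr1 (fun x => x * gweight q nu)).
  exact: esym (etrans (congr1 _ (fourier_c nu (bU _ yb))) (nmM _ _)).
rewrite ler_wpM2r ?gweight_ge0 ?(ltW q0) //.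
exact: fourier_le bU hM yb.
Qed.

Lemma compact_term_bound (K : set V) : compact K -> K `<=` U ->
  exists M q : R, [/\ 0 <= M, 0 <= q, q < 1 & forall z, K z ->
      forall nu, nm (c nu * monom z nu) <= M * gweight q nu].
Proof.
(* A single index i bounds both constants, M by i and q by 1 - 1/(i+1). Both bounds weaken as i
   grows, as [compact_uniform] requires. *)
move=> cK KU; pose Q (i : nat) : R := 1 - i.+1%:R^-1.
have Q0 i : 0 <= Q i.
  by rewrite subr_ge0 invf_le1 ?ltr0n // ler1n.
have Q1 i : Q i < 1 by rewrite ltrBlDr ltrDl invr_gt0 ltr0n.
have [m hm] : exists m, forall z, K z -> forall nu,
    nm (c nu * monom z nu) <= m%:R * gweight (Q m) nu.
  apply: (compact_uniform cK) => p Kp.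
  have [d d0 [M [q [M0 q0 q1 hM]]]] := local_term_bound (KU _ Kp).
  exists d => //; have dq : 0 < 1 - q by rewrite subr_gt0.
  have b0 : 0 <= M + (1 - q)^-1 by rewrite addr_ge0 // invr_ge0 ltW.
  exists (Num.bound (M + (1 - q)^-1)) => z i zp hi nu.
  have ib : M + (1 - q)^-1 <= i%:R.
    by rewrite (le_trans (ltW (archi_boundP b0))) // ler_nat.
  rewrite (le_trans (hM _ zp nu)) // ler_pM ?gweight_ge0 //.
    by rewrite (le_trans _ ib) // lerDl invr_ge0 ltW.
  apply: le_gweight => //; rewrite /Q lerBrDr addrC -lerBrDr.
  rewrite -[leRHS]invrK lef_pV2 ?posrE ?ltr0n ?invr_gt0 //.
  rewrite (le_trans _ (_ : i%:R <= _)) ?ler_nat //.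
  by rewrite (le_trans _ ib) // lerDr.
by exists m%:R, (Q m); split.
Qed.

Lemma compact_tail (K : set V) (e : R) : compact K -> K `<=` U -> 0 < e ->
  exists m, forall z, K z -> forall s : seq 'rV[int]_n, uniq s ->
  (forall nu, nu \in s -> ~ index_box m nu) ->
  \sum_(nu <- s) nm (c nu * monom z nu) <= e.
Proof.
move=> cK KU e0; have [M [q [M0 q0 q1 hM]]] := compact_term_bound cK KU.
have [u [u0 _ ue]] := small_factor M0 e0.
have [m hm] := gweight_tail n q0 q1 u0.
exists m => z Kz s us hs; apply: (@le_trans _ _ (\sum_(nu <- s) M * gweight q nu)).
  by apply: ler_sum => nu _; exact: hM.
by rewrite -mulr_sumr (le_trans _ ue) // mulrC ler_wpM2r // hm.
Qed.

Lemma laurent_normally_convergent : normally_convergent U (fun nu => c nu : R[i]^o).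
Proof.
move=> K cK KU eps e0; have e20 : 0 < eps / 2 by rewrite divr_gt0.
have [m hm] := compact_tail cK KU e20.
exists (index_box m); split; first exact: finite_index_box.
(* A supremum of finite sums only inherits a weak inequality, hence the margin [eps / 2]. *)
move=> z Kz; apply: (@le_lt_trans _ _ (eps / 2)%:E); last first.
  by rewrite lte_fin ltr_pdivrMr // mulr_natr mulr2n ltrDl.
apply: ge_ereal_sup => _ [A [fA AL] <-].
rewrite fsbig_finite // sumEFin lee_fin; apply: hm => //; first exact: finmap.fset_uniq.
by move=> nu; rewrite in_fset_set // inE => /AL.
Qed.

End LaurentBounds.

(** * Fejer kernel and the sum of the series *)

Section FejerKernel.
Variables (R : realType) (n : nat).
Implicit Types (t : R) (th : 'I_n -> R) (nu mu : 'rV[int]_n) (m N : nat).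

Definition ravg N (psi : ('I_n -> R) -> R) : R :=
  N%:R^-1 ^+ n * \sum_(k : {ffun 'I_n -> 'I_N}) psi (grid R k).

Lemma nm_avg_ravg N (phi : ('I_n -> R) -> R[i]) (psi : ('I_n -> R) -> R) :
  (forall th, nm (phi th) <= psi th) -> nm (avg N phi) <= ravg N psi.
Proof.
move=> h; have w0 : 0 <= N%:R^-1 ^+ n :> R by rewrite exprn_ge0 // invr_ge0.
rewrite nmM nm_real ger0_norm // ler_wpM2l // (le_trans (nm_sum _ _ _)) //.
by apply: ler_sum => k _; exact: h.
Qed.

Lemma le_ravg N (phi psi : ('I_n -> R) -> R) :
  (forall th, phi th <= psi th) -> ravg N phi <= ravg N psi.
Proof.
move=> h; have w0 : 0 <= N%:R^-1 ^+ n :> R by rewrite exprn_ge0 // invr_ge0.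
by rewrite ler_wpM2l //; apply: ler_sum => k _; exact: h.
Qed.

Lemma ravgD N (phi psi : ('I_n -> R) -> R) :
  ravg N (fun th => phi th + psi th) = ravg N phi + ravg N psi.
Proof. by rewrite /ravg big_split mulrDr. Qed.

Lemma ravgZ N (a : R) (phi : ('I_n -> R) -> R) :
  ravg N (fun th => a * phi th) = a * ravg N phi.
Proof. by rewrite /ravg -mulr_sumr mulrCA. Qed.

Lemma ravg_sum N (I : finType) (F : I -> ('I_n -> R) -> R) :
  ravg N (fun th => \sum_i F i th) = \sum_i ravg N (F i).
Proof. by rewrite /ravg exchange_big mulr_sumr. Qed.

Lemma ravg_prod N (psi : 'I_n -> R -> R) :
  ravg N (fun th => \prod_j psi j (th j)) =
  \prod_j (N%:R^-1 * \sum_(l < N) psi j (angle R N l)).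
Proof.
rewrite /ravg big_split /= prodr_const card_ord; congr (_ * _).
by rewrite bigA_distr_bigA.
Qed.

Definition fejer m t : R := nm (\sum_(a < m) expi t ^+ a) ^+ 2 / m%:R.

Lemma fejer_ge0 m t : 0 <= fejer m t.
Proof. by rewrite /fejer mulr_ge0 ?invr_ge0 // sqr_ge0. Qed.

Lemma fejer_expand m t : ((fejer m t)%:C)%C =
  (m%:R^-1)%:C%C * ((\sum_(a < m) expi t ^+ a) * \sum_(b < m) (expi t)^-1 ^+ b).
Proof.
rewrite /fejer rmorphM rmorphXn /= mulrC; congr (_ * _).
rewrite -normrE_nm sqr_normc; congr (_ * _); rewrite rmorph_sum.
apply: eq_bigr => b _; rewrite rmorphXn -expiN; congr (_ ^+ b).
by rewrite /expi cosN sinN.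
Qed.

(** Multiplication by 1 - e^(it) telescopes the geometric sum to 1 - e^(imt), of modulus at most
    2. *)
Lemma fejer_decay m t : (0 < m)%N -> fejer m t * nm (1 - expi t) ^+ 2 <= 4 / m%:R.
Proof.
move=> m0; rewrite /fejer mulrAC ler_wpM2r ?invr_ge0 // -exprMn -nmM mulrC.
have -> : (1 - expi t) * \sum_(a < m) expi t ^+ a = 1 - expi t ^+ m.
  by apply/eqP; rewrite -opprB mulNr -subrX1 opprB.
have h : nm (1 - expi t ^+ m) <= 2.
  rewrite (le_trans (nmD _ _)) // nmN nm1 nm_exprn nm_expi expr1n.
  by rewrite -mulr2n.
have -> : (4 : R) = 2 ^+ 2 by rewrite expr2 -natrM.
by rewrite lerXn2r ?nnegrE ?nm_ge0.
Qed.

(** The frequencies a - b satisfy |a - b| < m <= N, so on the grid only the m diagonal terms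
    survive, exactly and not just in the limit. *)
Lemma mean_fejer m N : (0 < m)%N -> (m <= N)%N ->
  N%:R^-1 * \sum_(l < N) fejer m (angle R N l) = 1.
Proof.
move=> m0 mN; have N0 : (0 < N)%N by exact: leq_trans mN.
apply: complexI; rewrite rmorphM rmorph_sum /=.
rewrite -[LHS]/(avg1 N (fun t => ((fejer m t)%:C)%C)).
have E t : ((fejer m t)%:C)%C = (m%:R^-1)%:C%C *
    \sum_(a < m) \sum_(b < m) expi t ^ (a%:Z - b%:Z).
  rewrite fejer_expand mulr_suml; congr (_ * _); apply: eq_bigr => a _.
  rewrite mulr_sumr; apply: eq_bigr => b _.
  by rewrite expfzDr ?expi_neq0 // -invr_expz exprVn.
rewrite /avg1; under eq_bigr do rewrite E.
rewrite -mulr_sumr mulrCA exchange_big /=.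
under eq_bigr do rewrite exchange_big /=.
have D (a b : 'I_m) : (N%:R^-1)%:C%C * \sum_(l < N) expi (angle R N l) ^ (a%:Z - b%:Z) =
    (a == b)%:R :> R[i].
  have [->|ab] := eqVneq a b.
    by rewrite subrr; exact: avg1_cst.
  apply: (@avg1_expi_eq0 R N (a%:Z - b%:Z)).
  by move: (ltn_ord a) (ltn_ord b) ab; rewrite -(inj_eq val_inj) /=; lia.
rewrite mulr_sumr; under eq_bigr do rewrite mulr_sumr.
under eq_bigr => a _.
  under eq_bigr => b _ do rewrite D.
  rewrite (bigD1 a) //= eqxx big1 ?addr0; last first.
    by move=> b; rewrite eq_sym => /negbTE ->.
  over.
rewrite sumr_const card_ord -(rmorph_nat (real_complex R)) -rmorphM.
by rewrite mulVf // pnatr_eq0 -lt0n.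
Qed.

Definition fejern m th : R := \prod_j fejer m (th j).

Lemma fejern_ge0 m th : 0 <= fejern m th.
Proof. by apply: prodr_ge0 => j _; exact: fejer_ge0. Qed.

Lemma ravg_fejern m N : (0 < m)%N -> (m <= N)%N -> ravg N (fejern m) = 1.
Proof.
move=> m0 mN; rewrite -[LHS]/(ravg N (fun th => \prod_j fejer m (th j))).
rewrite (ravg_prod N (fun=> fejer m)).
by apply: big1 => j _; exact: mean_fejer.
Qed.

Lemma ravg_fejern_decay m N j : (0 < m)%N -> (m <= N)%N ->
  ravg N (fun th => fejern m th * nm (1 - expi (th j)) ^+ 2) <= 4 / m%:R.
Proof.
move=> m0 mN; have N0 : (0 < N)%N by exact: leq_trans mN.
pose psi (i : 'I_n) (t : R) := if i == j then 1 else fejer m t.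
apply: (@le_trans _ _ (ravg N (fun th => 4 / m%:R * \prod_i psi i (th i)))).
  apply: le_ravg => th; rewrite /fejern (bigD1 j) //= mulrAC.
  rewrite [X in _ <= _ * X](bigD1 j) //= {1}/psi eqxx mul1r.
  rewrite [X in _ <= _ * X](eq_bigr (fun i => fejer m (th i))); last first.
    by move=> i /negbTE; rewrite /psi => ->.
  rewrite ler_wpM2r ?fejer_decay //.
  by apply: prodr_ge0 => i _; exact: fejer_ge0.
rewrite ravgZ (ravg_prod N psi) big1 ?mulr1 // => i _; rewrite /psi; case: eqP => _.
  by rewrite sumr_const card_ord mulVf // pnatr_eq0 -lt0n.
exact: mean_fejer.
Qed.

(** Away from the angle 0 some |1 - e^(i th_j)| is at least r, so M is at most M / r^2 times the sum
    of their squares, whose mean against the kernel is O(1/m). The bound is free of [N], so N may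
    tend to infinity with m fixed. *)
Lemma fejer_approximation m N (D : ('I_n -> R) -> R[i]) (D0 : R[i]) (delta r M : R) :
  (0 < m)%N -> (m <= N)%N -> 0 <= delta -> 0 < r -> 0 <= M ->
  (forall th, (forall j, nm (1 - expi (th j)) < r) -> nm (D th - D0) <= delta) ->
  (forall th, nm (D th - D0) <= M) ->
  nm (avg N (fun th => ((fejern m th)%:C)%C * D th) - D0)
    <= delta + M / r ^+ 2 * n%:R * (4 / m%:R).
Proof.
move=> m0 mN d0 r0 M0 near far; have N0 : (0 < N)%N by exact: leq_trans mN.
have C0 : 0 <= M / r ^+ 2 by rewrite divr_ge0 // exprn_ge0 // ltW.
have pw th : nm (D th - D0) <= delta + M / r ^+ 2 * \sum_j nm (1 - expi (th j)) ^+ 2.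
  have S0 : 0 <= \sum_j nm (1 - expi (th j)) ^+ 2 by apply: sumr_ge0 => j _; exact: sqr_ge0.
  have [h|h] := pselect (forall j, nm (1 - expi (th j)) < r).
    by rewrite (le_trans (near _ h)) // lerDl mulr_ge0.
  have [j hj] : exists j, r <= nm (1 - expi (th j)).
    apply: contrapT => nj; apply: h => j; rewrite ltNge; apply/negP => hj.
    by apply: nj; exists j.
  rewrite (le_trans (far th)) // -[leLHS]add0r lerD // mulrAC ler_pdivlMr ?exprn_gt0 //.
  rewrite ler_wpM2l // (bigD1 j) //= -[leLHS]addr0 lerD //.
    by rewrite lerXn2r // nnegrE ?nm_ge0 // ltW.
  by apply: sumr_ge0 => i _; exact: sqr_ge0.
have avgW : avg N (fun th => ((fejern m th)%:C)%C) = 1.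
  rewrite -[RHS](rmorph1 (real_complex R)) -(ravg_fejern m0 mN).
  by rewrite /ravg rmorphM rmorph_sum.
have -> : avg N (fun th => ((fejern m th)%:C)%C * D th) - D0 =
    avg N (fun th => ((fejern m th)%:C)%C * (D th - D0)).
  rewrite -[D0 in LHS]mulr1 -avgW -avgZ -avgB; apply: eq_avg => th.
  by rewrite mulrBr [D0 * _]mulrC.
apply: (@le_trans _ _ (ravg N (fun th => delta * fejern m th + M / r ^+ 2 *
    \sum_j fejern m th * nm (1 - expi (th j)) ^+ 2))).
  apply: nm_avg_ravg => th; rewrite nmM nm_real ger0_norm ?fejern_ge0 //.
  have -> : delta * fejern m th + M / r ^+ 2 * \sum_j fejern m th * nm (1 - expi (th j)) ^+ 2
    = fejern m th * (delta + M / r ^+ 2 * \sum_j nm (1 - expi (th j)) ^+ 2).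
    by rewrite -mulr_sumr; ring.
  by rewrite ler_wpM2l ?fejern_ge0.
rewrite ravgD !ravgZ ravg_sum ravg_fejern // mulr1 lerD2l -[leRHS]mulrA ler_wpM2l //.
apply: (@le_trans _ _ (\sum_(j < n) (4 / m%:R))).
  by apply: ler_sum => j _; exact: ravg_fejern_decay.
by rewrite sumr_const card_ord -[leLHS]mulr_natl.
Qed.

Definition index_row m (A : {ffun 'I_n -> 'I_m}) : 'rV[int]_n := \row_j (nat_of_ord (A j))%:Z.

Lemma index_row_inj m : injective (@index_row m).
Proof.
move=> A B /rowP e; apply/ffunP => j; apply: val_inj.
by have := e j; rewrite !mxE => -[].
Qed.

Lemma chi_index_row m (A : {ffun 'I_n -> 'I_m}) th :
  chi (index_row A) th = \prod_j expi (th j) ^+ (A j).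
Proof. by apply: eq_bigr => j _; rewrite mxE. Qed.

Lemma chiN nu th : chi (- nu) th = (chi nu th)^-1 :> R[i].
Proof.
have c0 : chi nu th != 0 :> R[i] by rewrite -nm_eq0 nm_chi oner_eq0.
by apply: (mulfI c0); rewrite mulfV // -chiD subrr chi0.
Qed.

(** Kept as an unweighted double sum: for fixed A the indices B - A are distinct, so each inner sum
    can be compared with a tail of the coefficients. *)
Lemma fejern_expand m th : ((fejern m th)%:C)%C = ((m%:R^-1 ^+ n)%:C)%C *
  \sum_(A : {ffun 'I_n -> 'I_m}) \sum_(B : {ffun 'I_n -> 'I_m})
    chi (- (index_row B - index_row A)) th.
Proof.
have E1 : \prod_j \sum_(a < m) expi (th j) ^+ a =
    \sum_(A : {ffun 'I_n -> 'I_m}) chi (index_row A) th.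
  by rewrite bigA_distr_bigA; apply: eq_bigr => A _; rewrite chi_index_row.
have E2 : \prod_j \sum_(b < m) (expi (th j))^-1 ^+ b =
    \sum_(B : {ffun 'I_n -> 'I_m}) chi (- index_row B) th.
  rewrite bigA_distr_bigA; apply: eq_bigr => B _.
  rewrite chiN chi_index_row -prodfV; apply: eq_bigr => j _; exact: exprVn.
rewrite /fejern rmorph_prod /=; under eq_bigr do rewrite fejer_expand.
rewrite big_split /= prodr_const card_ord rmorphXn; congr (_ * _).
rewrite big_split /= E1 E2 mulr_suml; apply: eq_bigr => A _.
by rewrite mulr_sumr; apply: eq_bigr => B _; rewrite -chiD opprB.
Qed.

End FejerKernel.

(** * Convergence of the series to the function *)

Section LaurentSum.
Variables (R : realType) (n : nat).
Local Notation V := 'rV[R[i]^o]_n.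
Variables (U : set V) (g : V -> R[i]^o).
Implicit Types (z p : V) (nu : 'rV[int]_n) (th : 'I_n -> R).
Hypothesis rotU : forall z, U z -> forall th, U (rot th z).
Hypothesis dg : forall z, U z -> differentiable g z.

Lemma nm_exprz_sub1 (u : R[i]) (k : int) : nm u = 1 -> nm (u ^ k - 1) <= `|k|%N%:R * nm (u - 1).
Proof.
move=> u1; have pos (m : nat) : nm (u ^+ m - 1) <= m%:R * nm (u - 1).
  elim: m => [|m ih]; first by rewrite expr0 subrr nm0 mul0r.
  have -> : u ^+ m.+1 - 1 = u * (u ^+ m - 1) + (u - 1) by rewrite exprS; ring.
  by rewrite (le_trans (nmD _ _)) // nmM u1 mul1r -natr1 mulrDl mul1r lerD2r.
case: (intP k) => [|m|m]; [exact: (pos 0%N)|exact: (pos m.+1)|].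
have um0 : u ^+ m.+1 != 0 by rewrite expf_neq0 // -nm_eq0 u1 oner_eq0.
have -> : u ^ (- m.+1%:Z) - 1 = (u ^+ m.+1)^-1 * (1 - u ^+ m.+1).
  by rewrite -invr_expz mulrBr mulr1 mulVf.
by rewrite abszN nmM nmV nm_exprn u1 expr1n invr1 mul1r nmB; exact: pos.
Qed.

Lemma nm_prod_sub1 (I : Type) (s : seq I) (F : I -> R[i]) : (forall i, nm (F i) = 1) ->
  nm (\prod_(i <- s) F i - 1) <= \sum_(i <- s) nm (F i - 1).
Proof.
move=> F1; elim: s => [|i s ih]; first by rewrite !big_nil subrr nm0.
rewrite !big_cons.
have -> : F i * \prod_(j <- s) F j - 1 = F i * (\prod_(j <- s) F j - 1) + (F i - 1) by ring.
by rewrite (le_trans (nmD _ _)) // nmM F1 mul1r addrC lerD2l.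
Qed.

Lemma nm_chi_sub1 nu th : nm (chi nu th - 1) <=
  \sum_j `|(nu 0 j)%R|%N%:R * nm (1 - expi (th j)).
Proof.
have u1 j : nm (expi (th j) ^ nu 0 j) = 1 by rewrite nm_exprz nm_expi exp1rz.
apply: (le_trans (nm_prod_sub1 _ u1)).
by apply: ler_sum => j _; rewrite [nm (1 - _)]nmB nm_exprz_sub1 // nm_expi.
Qed.

Lemma rot_close z (d r : R) th : r * \sum_j nm (z 0 j) <= d / 2 -> 0 < d -> 0 < r ->
  (forall j, nm (1 - expi (th j)) < r) -> close d z (rot th z).
Proof.
move=> rz d0 r0 h j; rewrite mxE -{2}[z 0 j]mul1r -mulrBl nmM nmB.
apply: (@le_lt_trans _ _ (d / 2)); last by rewrite ltr_pdivrMr // mulr_natr mulr2n ltrDl.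
rewrite (le_trans _ rz) //; apply: ler_pM; rewrite ?nm_ge0 //; first exact: ltW (h j).
by rewrite (bigD1 j) //= lerDl sumr_ge0 // => i _; exact: nm_ge0.
Qed.

Lemma avg_chi_limit (k : R[i]) mu nu :
  ctends (fun N => avg N.+1 (fun th => chi (- nu) th * (k * chi mu th)))
    (if mu == nu then k else 0).
Proof.
apply: ctends_near (ctends_cst _).
exists (\max_j `|((mu - nu) 0 j)%R|%N) => N hN.
have -> : avg N.+1 (fun th => chi (- nu) th * (k * chi mu th)) =
    k * avg N.+1 (chi (mu - nu)).
  by rewrite -avgZ; apply: eq_avg => th; rewrite mulrCA -chiD [- nu + mu]addrC.
have [->|mn] := eqVneq mu nu; first by rewrite subrr avg_chi0 // mulr1.
rewrite avg_chi_eq0 ?mulr0 ?subr_eq0 // => j.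
by rewrite ltnS (leq_trans _ hN) // (leq_bigmax (F := fun j => `|((mu - nu) 0 j)%R|%N)).
Qed.

Lemma sum_seq_delta (s : seq 'rV[int]_n) (F : 'rV[int]_n -> R[i]) nu : uniq s ->
  \sum_(mu <- s) (if mu == nu then F mu else 0) = if nu \in s then F nu else 0.
Proof.
move=> us; case: ifPn => ns.
  by rewrite (bigD1_seq nu) //= eqxx big1 ?addr0 // => mu /negbTE ->.
rewrite big_seq big1 // => mu ms; case: eqP => // e.
by rewrite -e ms in ns.
Qed.

(** By orthogonality of characters, subtracting the terms of [s] removes exactly these coefficients
    and leaves the others unchanged. *)
Lemma fourier_remainder_limit z (s : seq 'rV[int]_n) nu : U z -> uniq s ->
  ctends (fun N => avg N.+1 (fun th => chi (- nu) th *
     (g (rot th z) - \sum_(mu <- s) fourier g z mu * chi mu th)))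
    (if nu \in s then 0 else fourier g z nu).
Proof.
move=> Uz us.
have S := ctendsB (fourier_limit rotU dg nu Uz)
  (ctends_sum s (fun mu => avg_chi_limit (fourier g z mu) mu nu)).
have -> : (if nu \in s then 0 else fourier g z nu) =
    fourier g z nu - \sum_(mu <- s) (if mu == nu then fourier g z mu else 0).
  by rewrite sum_seq_delta //; case: ifP; rewrite ?subrr ?subr0.
apply: ctends_near S; exists 0%N => N _; rewrite -avg_sum -avgB; apply: eq_avg => th.
by rewrite mulrBr mulr_sumr [g _ * _]mulrC.
Qed.

Lemma laurent_partial_sum z (s : seq 'rV[int]_n) (e : R) : U z -> uniq s ->
  (forall s', uniq s' -> (forall nu, nu \in s' -> nu \notin s) ->
     \sum_(nu <- s') nm (fourier g z nu) <= e) ->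
  nm (g z - \sum_(nu <- s) fourier g z nu) <= e.
Proof.
move=> Uz us tail.
have e0 : 0 <= e by have := tail [::]; rewrite big_nil; apply.
pose F nu : R[i] := fourier g z nu.
have [D DE] : exists D, D = fun th => g (rot th z) - \sum_(mu <- s) F mu * chi mu th by eexists.
have [D0 D0E] : exists D0 : R[i], D0 = g z - \sum_(nu <- s) F nu by eexists.
rewrite -D0E; apply/ler_addgt0Pr => d d0.
have d20 : 0 < d / 2 by rewrite divr_gt0.
have d40 : 0 < d / 2 / 2 by rewrite divr_gt0.
have [M M0 hM] := compact_bounded dg (compact_torus (z:=z)) (torus_sub rotU Uz).
have [d1 d10 hd1] := differentiable_close (dg Uz) d40.
have Z0 : 0 <= \sum_j nm (z 0 j) by apply: sumr_ge0 => j _; exact: nm_ge0.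
pose L := \sum_(nu <- s) nm (F nu) * \sum_j `|(nu 0 j)%R|%N%:R.
have L0 : 0 <= L.
  by apply: sumr_ge0 => nu _; rewrite mulr_ge0 ?nm_ge0 // sumr_ge0.
have d120 : 0 < d1 / 2 by rewrite divr_gt0.
have [r1 [r10 _ r1Z]] := small_factor Z0 d120.
have [r2 [r20 _ r2L]] := small_factor L0 d40.
pose r := Num.min r1 r2; have r0 : 0 < r by rewrite lt_min r10.
have DD0 th : D th - D0 = (g (rot th z) - g z) - \sum_(nu <- s) F nu * (chi nu th - 1).
  rewrite DE D0E; have -> : \sum_(nu <- s) F nu * (chi nu th - 1) =
      \sum_(nu <- s) F nu * chi nu th - \sum_(nu <- s) F nu.
    by rewrite -sumrB; apply: eq_bigr => nu _; rewrite mulrBr mulr1.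
  by ring.
have near th : (forall j, nm (1 - expi (th j)) < r) -> nm (D th - D0) <= d / 2.
  move=> h; rewrite DD0 (le_trans (nmD _ _)) // nmN [leRHS]splitr lerD //.
    apply/ltW/hd1; apply: (@rot_close _ _ r1) => // j.
    by rewrite (lt_le_trans (h j)) // ge_min lexx.
  rewrite (le_trans (nm_sum _ _ _)) // (le_trans _ r2L) // /L mulr_sumr.
  apply: ler_sum => nu _; rewrite nmM mulrCA ler_wpM2l ?nm_ge0 //.
  rewrite (le_trans (nm_chi_sub1 _ _)) // mulr_sumr; apply: ler_sum => j _.
  rewrite mulrC ler_wpM2r // ltW // (lt_le_trans (h j)) //.
  by rewrite ge_min lexx orbT.
(* Crude bound away from the angle 0: the difference of two values of g is at most 2 M, and |chi -
   1| is at most 2. *)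
pose M' := 2 * M + \sum_(nu <- s) nm (F nu) * 2.
have M'0 : 0 <= M'.
  rewrite addr_ge0 ?mulr_ge0 // sumr_ge0 // => nu _.
  by rewrite mulr_ge0 // nm_ge0.
have far th : nm (D th - D0) <= M'.
  rewrite DD0 (le_trans (nmD _ _)) // nmN lerD //.
    rewrite (le_trans (nmD _ _)) // nmN mulr_natl mulr2n lerD ?hM //.
    exact: torus_rot.
  rewrite (le_trans (nm_sum _ _ _)) //; apply: ler_sum => nu _.
  rewrite nmM ler_wpM2l ?nm_ge0 // (le_trans (nmD _ _)) // nmN nm1 nm_chi.
  by rewrite -mulr2n.
pose C := M' / r ^+ 2 * n%:R * 4.
have C0 : 0 <= C by rewrite !mulr_ge0 // invr_ge0 exprn_ge0 // ltW.
have [m m0 mC] : exists2 m, (0 < m)%N & C / m%:R <= d / 2.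
  have p0 : 0 <= C / (d / 2) by rewrite divr_ge0 // ltW.
  exists (Num.bound (C / (d / 2))).+1 => //.
  rewrite ler_pdivrMr ?ltr0n // mulrC -ler_pdivrMr //.
  by rewrite (le_trans (ltW (archi_boundP p0))) // ler_nat.
pose G nu : R[i] := if nu \in s then 0 else F nu.
(* The m-th Fejer mean of the remainder, as a limit of grid averages. It is within [d] of the
   remainder at angle 0, and bounded by the tail. *)
pose Lim : R[i] := ((m%:R^-1 ^+ n)%:C)%C * \sum_(A : {ffun 'I_n -> 'I_m})
   \sum_(B : {ffun 'I_n -> 'I_m}) G (index_row B - index_row A).
have toLim : ctends (fun N => avg N.+1 (fun th => ((fejern m th)%:C)%C * D th)) Lim.
  have H := ctendsZ ((m%:R^-1 ^+ n)%:C)%C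
    (ctends_sum (index_enum {ffun 'I_n -> 'I_m}) (fun A =>
      ctends_sum (index_enum {ffun 'I_n -> 'I_m}) (fun B =>
        fourier_remainder_limit (index_row B - index_row A) Uz us))).
  apply: ctends_near H; exists 0%N => N _.
  rewrite -[RHS](@eq_avg _ _ _ (fun th => ((m%:R^-1 ^+ n)%:C)%C * \sum_(A : {ffun 'I_n -> 'I_m})
     \sum_(B : {ffun 'I_n -> 'I_m}) (chi (- (index_row B - index_row A)) th * D th))).
    rewrite avgZ avg_sum; congr (_ * _); apply: eq_bigr => A _.
    by rewrite avg_sum DE.
  move=> th; rewrite fejern_expand -mulrA; congr (_ * _); rewrite mulr_suml.
  by apply: eq_bigr => A _; rewrite mulr_suml.
have Lime : nm Lim <= e.
  have w0 : 0 <= m%:R^-1 ^+ n :> R by rewrite exprn_ge0 // invr_ge0.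
  rewrite nmM nm_real ger0_norm // -[leRHS](avg_weight_sum n e m0) ler_wpM2l //.
  rewrite (le_trans (nm_sum _ _ _)) //; apply: ler_sum => A _.
  rewrite (le_trans (nm_sum _ _ _)) //.
  (* For fixed A the sum over B runs over distinct coefficients outside [s], so it is at most [e];
     the normalising factor m^(-n) then averages over A. *)
  pose f (B : {ffun 'I_n -> 'I_m}) := index_row B - index_row A.
  have finj : injective f by move=> B B' /addIr /index_row_inj.
  pose s' := [seq nu <- map f (index_enum {ffun 'I_n -> 'I_m}) | nu \notin s].
  apply: (@le_trans _ _ (\sum_(nu <- s') nm (F nu))).
    rewrite big_filter big_map [leRHS]big_mkcond; apply: ler_sum => B _.
    by rewrite /G -/(f B); case: (f B \in s); rewrite ?nm0.
  apply: tail; first by rewrite filter_uniq // map_inj_uniq // index_enum_uniq.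
  by move=> nu; rewrite mem_filter => /andP[].
have LimD : nm (Lim - D0) <= d.
  apply: ctends_nm_le (ctendsB toLim (ctends_cst D0)); exists m => N mN.
  rewrite (le_trans (fejer_approximation m0 (leqW mN) (ltW d20) r0 M'0 near far)) //.
  by rewrite [leRHS]splitr lerD2l // mulrA.
rewrite -[D0](subrK Lim) addrC (le_trans (nmD _ _)) // lerD //.
by rewrite nmB.
Qed.

End LaurentSum.

(** * Uniqueness and measurability *)

Lemma mem_enum_fset_set (T : choiceType) (A : set T) (x : T) : finite_set A ->
  (x \in finmap.enum_fset (fset_set A)) = (x \in A).
Proof. by move=> fA; exact: (in_fset_set fA x). Qed.

Section CoefficientUniqueness.
Variables (R : realType) (n : nat).
Local Notation V := 'rV[R[i]^o]_n.
Variables (U : set V) (g : V -> R[i]^o) (a : 'rV[int]_n -> R[i]^o).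
Implicit Types (z p : V) (nu mu : 'rV[int]_n) (th : 'I_n -> R).
Hypothesis rotU : forall z, U z -> forall th, U (rot th z).

Lemma monom_rot z th nu : monom (rot th z) nu = chi nu th * monom z nu.
Proof.
have E : monom (rot th z) nu = \prod_j (expi (th j) ^ nu 0 j * (z 0 j : R[i]) ^ nu 0 j).
  by apply: eq_bigr => j _; rewrite mxE; exact: expfzMl.
by rewrite E big_split.
Qed.

(** Pointwise summation gives a finite set depending on z, normal convergence one that serves all of
    [K]. Passing through their union, the terms outside the uniform set cost only its tail. The
    index [mu] is adjoined for [laurent_coefficient]. *)
Lemma uniform_partial_sum (K : set V) (e : R) mu : converges_normally_to U a g ->
  compact K -> K `<=` U -> 0 < e ->
  exists s : seq 'rV[int]_n, [/\ uniq s, mu \in s &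
    forall z, K z -> nm (g z - \sum_(nu <- s) (a nu : R[i]) * monom z nu) <= e].
Proof.
move=> [na ga] cK KU e0; have e20 : 0 < e / 2 by rewrite divr_gt0.
have [L [fL hL]] := na K cK KU _ e20.
pose L1 := L `|` [set mu].
have fL1 : finite_set L1 by rewrite finite_setU.
exists (finmap.enum_fset (fset_set L1)); split.
- exact: finmap.fset_uniq.
- by rewrite mem_enum_fset_set // inE; right.
move=> z Kz; have [L0 [fL0 hL0]] := ga z (KU _ Kz) _ e20.
pose L2 := L0 `|` L1; have fL2 : finite_set L2 by rewrite finite_setU.
have := hL0 L2 fL2 (@subsetUl _ _ _); rewrite fsbig_finite //.
pose F nu : R[i] := (a nu : R[i]) * monom z nu.
have sub nu : nu \in finmap.enum_fset (fset_set L1) -> nu \in finmap.enum_fset (fset_set L2).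
  by rewrite !mem_enum_fset_set // !inE; right.
have -> : (\sum_(nu <- finmap.enum_fset (fset_set L2)) a nu * monom z nu : R[i]) =
    \sum_(nu <- finmap.enum_fset (fset_set L1)) F nu +
    \sum_(nu <- finmap.enum_fset (fset_set L2) | nu \notin finmap.enum_fset (fset_set L1))
      F nu.
  rewrite -/(\sum_(nu <- finmap.enum_fset (fset_set L2)) F nu).
  rewrite (bigID (mem (finmap.enum_fset (fset_set L1)))) /=.
  congr (_ + _); rewrite -big_filter; apply: perm_big.
  apply: uniq_perm; rewrite ?filter_uniq ?finmap.fset_uniq // => nu.
  by rewrite mem_filter; apply/andP/idP => [[]|h] //; split=> //; exact: sub.
rewrite opprD addrA; set X := g z - _; set Y := \sum_(nu <- _ | _) _ => h.
have fL21 : finite_set (L2 `\` L1) by exact: finite_setD.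
have Ye : nm Y <= e / 2.
  rewrite (le_trans (nm_sum _ _ _)) // -lee_fin.
  apply: le_trans (ltW (hL z Kz)); apply: esum_ge.
  exists (L2 `\` L1).
    by split=> // nu [_ h1] Lnu; apply: h1; left.
  rewrite fsbig_finite // sumEFin lee_fin le_eqVlt; apply/orP; left; apply/eqP.
  rewrite -[LHS]big_filter; apply: perm_big.
  apply: uniq_perm; rewrite ?filter_uniq ?finmap.fset_uniq // => nu.
  rewrite mem_filter !mem_enum_fset_set //; apply/andP/idP; rewrite !inE.
    by move=> [/negP h1 h2]; split=> // /mem_set.
  by move=> [h1 h2]; split=> //; apply/negP => /set_mem.
rewrite -[X](subrK Y) (le_trans (nmD _ _)) // [leRHS]splitr lerD // ltW //.
Qed.

(** Grid averages do not increase a uniform error on the torus, and those of a finite partial sum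
    containing [mu] single out its term. *)
Lemma laurent_coefficient z mu : converges_normally_to U a g -> U z ->
  ctends (fun N => avg N.+1 (fun th => g (rot th z) * chi (- mu) th))
    ((a mu : R[i]) * monom z mu).
Proof.
move=> ag Uz e e0; have e20 : 0 < e / 2 by rewrite divr_gt0.
have [s [us mus hs]] := uniform_partial_sum mu ag (compact_torus (z:=z)) (torus_sub rotU Uz) e20.
pose F nu : R[i] := (a nu : R[i]) * monom z nu.
have Y := ctends_sum s (fun nu => avg_chi_limit (F nu) nu mu).
rewrite sum_seq_delta // mus in Y.
have [N0 hN0] := Y _ e20; exists N0 => N /hN0 hN.
rewrite [leRHS]splitr.
apply: le_trans (nm_dist (\sum_(nu <- s)
  avg N.+1 (fun th => chi (- mu) th * (F nu * chi nu th))) _ _) _.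
apply: lerD; last exact: hN.
rewrite -avg_sum -avgB; apply: nm_avg_le => // k; set th := grid R k.
have -> : g (rot th z) * chi (- mu) th - \sum_(nu <- s) chi (- mu) th * (F nu * chi nu th)
  = (g (rot th z) - \sum_(nu <- s) (a nu : R[i]) * monom (rot th z) nu) * chi (- mu) th.
  rewrite mulrBl; congr (_ - _); rewrite mulr_suml; apply: eq_bigr => nu _.
  by rewrite monom_rot /F mulrC; congr (_ * _); rewrite -mulrA [monom _ _ * _]mulrC.
by rewrite nmM nm_chi mulr1; apply: hs; exact: torus_rot.
Qed.

End CoefficientUniqueness.

(** * Measurability of complex limits *)

Section ComplexMeasurability.
Context (d : measure_display) (T : measurableType d) (R : realType).
Implicit Types h : T -> R[i].

Lemma measurable_cplxD h h' : measurable_cplx (h : T -> R[i]^o) ->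
  measurable_cplx (h' : T -> R[i]^o) -> measurable_cplx ((fun w => h w + h' w) : T -> R[i]^o).
Proof.
move=> [r1 i1] [r2 i2]; split.
  by under eq_fun do rewrite Re_D; exact: measurable_funD.
by under eq_fun do rewrite Im_D; exact: measurable_funD.
Qed.

Lemma measurable_cplxZ (k : R[i]) h : measurable_cplx (h : T -> R[i]^o) ->
  measurable_cplx ((fun w => k * h w) : T -> R[i]^o).
Proof.
move=> [r1 i1]; split.
  under eq_fun do rewrite Re_M.
  by apply: measurable_funB; apply: measurable_funM => //; exact: measurable_cst.
under eq_fun do rewrite Im_M.
by apply: measurable_funD; apply: measurable_funM => //; exact: measurable_cst.
Qed.

Lemma measurable_cplx_sum (I : Type) (s : seq I) (F : I -> T -> R[i]) :
  (forall i, measurable_cplx (F i : T -> R[i]^o)) ->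
  measurable_cplx ((fun w => \sum_(i <- s) F i w) : T -> R[i]^o).
Proof.
move=> mF; elim: s => [|i s ih].
  under eq_fun do rewrite big_nil.
  by split; exact: measurable_cst.
under eq_fun do rewrite big_cons.
exact: measurable_cplxD.
Qed.

Lemma measurable_cplx_limit (u : nat -> T -> R[i]) (h : T -> R[i]) :
  (forall N, measurable_cplx (u N : T -> R[i]^o)) ->
  (forall w, ctends (u^~ w) (h w)) -> measurable_cplx (h : T -> R[i]^o).
Proof.
move=> mu uh; split.
  apply: (measurable_fun_cvg (fun N => (mu N).1)) => w _.
  exact: ctends_Re (uh w).
apply: (measurable_fun_cvg (fun N => (mu N).2)) => w _.
exact: ctends_Im (uh w).
Qed.

End ComplexMeasurability.

Theorem theorem4p6 (d : measure_display) (T : measurableType d)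
  (R : realType) (n : nat) (U : set 'rV[R[i]^o]_n)
  (f : T -> 'rV[R[i]^o]_n -> R[i]^o) :
  reinhardt_domain U -> random_holomorphic U f ->
  exists! c : T -> 'rV[int]_n -> R[i]^o,
    (forall nu, measurable_cplx (fun w => c w nu)) /\
    (forall w, converges_normally_to U (c w) (f w)).
Proof.
move=> [oU cU [p Up] rotU'] [hol meas].
have rotU z (Uz : U z) th : U (rot th z) by exact: rotU'.
have [z0 Uz0 nz0] : exists2 z0, U z0 & nonzero z0.
  have [e e0 he] := open_close oU Up.
  by have [z0 z0p nz0] := near_nonzero p e0; exists z0 => //; exact: he.
have m0 nu : monom z0 nu != 0 by exact: monom_neq0.
pose c w nu : R[i] := fourier (f w) z0 nu / monom z0 nu.
have fourier_c w z nu : U z -> fourier (f w) z nu = c w nu * monom z nu.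
  move=> Uz; apply: (mulIf (m0 nu)).
  apply: (etrans (fourier_monomial oU rotU (hol w) cU nu Uz0 nz0 Uz)).
  by rewrite /c mulrAC divfK.
exists c; split.
  split=> [nu|w].
    have -> : (fun w => c w nu) = (fun w => (monom z0 nu)^-1 * fourier (f w) z0 nu).
      by apply/funext => w; exact: mulrC.
    apply: measurable_cplxZ.
    (* For each N the grid is the same for all w, so the average is a fixed finite combination of
       functions f(., z). *)
    apply: measurable_cplx_limit (fun w => fourier_limit rotU (hol w) nu Uz0) => N.
    apply: measurable_cplxZ; apply: measurable_cplx_sum => k.
    under eq_fun do rewrite mulrC.
    exact: measurable_cplxZ (meas _).
  split; first exact: (laurent_normally_convergent oU rotU (hol w) (fourier_c w)).
  move=> z Uz e e0; have e20 : 0 < e / 2 by rewrite divr_gt0.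
  have zU : [set z] `<=` U by move=> _ ->.
  have [m hm] := compact_tail oU rotU (hol w) (fourier_c w) (compact_set1 (x:=z)) zU e20.
  exists (index_box m); split; first exact: finite_index_box.
  move=> L fL mL; rewrite fsbig_finite //.
  apply: (@le_lt_trans _ _ (e / 2)); last by rewrite ltr_pdivrMr // mulr_natr mulr2n ltrDl.
  rewrite (eq_bigr (fourier (f w) z)); last by move=> nu _; exact/esym/fourier_c.
  apply: (laurent_partial_sum rotU (hol w)) => //; first exact: finmap.fset_uniq.
  move=> s us hs; rewrite (eq_bigr (fun nu => nm (c w nu * monom z nu))); last first.
    by move=> nu _; rewrite fourier_c.
  apply: hm => // nu /hs; rewrite mem_enum_fset_set // => /negP nL Lnu.
  by apply: nL; apply: mem_set; exact: mL.
(* The same averages on the torus of [z0] converge to both coefficients times the monomial at [z0],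
   which is nonzero and cancels. *)
move=> c' [_ c'f]; apply/funext => w; apply/funext => nu.
have h1 := laurent_coefficient rotU nu (c'f w) Uz0.
have h2 := fourier_limit rotU (hol w) nu Uz0.
by rewrite /c (ctends_unique h2 h1) mulfK.
Qed.
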